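(* Let $R\in\mathbf{N}$, $R\geq 1$. If a vertex-transitive graph $X$ is LG-rigid at scale $R$, then $X$ is simply connected at scale $2R$.
   Context: A ''graph'' means a connected, locally finite graph without loops or multiple edges, equipped with the geodesic metric giving each edge length $1$; ''$x\in X$'' means that $x$ is a vertex of $X$; balls are closed balls. A covering from a graph $X$ to a graph $Y$ is a graph covering map (a surjective graph morphism which, for every vertex $x$, maps the neighbors of $x$ bijectively onto the neighbors of its image); $Y$ is covered by $X$ if such a map $X\to Y$ exists. Given a graph $X$ and $R>0$, a graph $Y$ is $R$-locally $X$ if for every vertex $y\in Y$ there exists $x\in X$ such that the balls $B_X(x,R)$ and $B_Y(y,R)$, equipped with their intrinsic geodesic metrics, are isometric. $X$ is LG-rigid at scale $R$ if every graph which is $R$-locally $X$ is covered by $X$. For a graph $X$ and $k\in\mathbf{N}$, $P_k(X)$ is the 2-dimensional CW-complex whose 1-skeleton is $X$ and whose 2-cells are $m$-gons, $0\le m\le k$, one attached along each simple loop $(x_0,\dots,x_m=x_0)$ of length $m$ in $X$ (up to cyclic permutations). $X$ is simply connected at scale $k$ if $P_k(X)$ is simply connected. *)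

(* Defs.v *)
From HB Require Import structures.
From mathcomp Require Import all_boot all_order all_algebra.
From mathcomp Require Import generic_quotient.
From mathcomp Require Import all_classical all_reals all_analysis.
From mathcomp Require Import homotopy.
From Stdlib Require Import Relation_Operators.

Set Implicit Arguments.
Unset Strict Implicit.
Unset Printing Implicit Defensive.

Import Order.TTheory GRing.Theory Num.Theory.
Import numFieldNormedType.Exports.

Local Open Scope classical_set_scope.
Local Open Scope ring_scope.
Local Open Scope quotient_scope.

(** Classically every type is a [choiceType] and every relation is boolean, so
    these two choices are no restriction. *)
Record graph := Graph {
  vertex :> choiceType;
  adj : rel vertex;
  adj_sym : symmetric adj;
  adj_irrefl : irreflexive adj;
  graph_nonempty : exists _ : vertex, True;
  graph_connected : forall x y, exists2 p, path adj x p & last x p = y;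
  graph_locally_finite : forall x, finite_set [set y | adj x y]
}.

Definition neighbors (X : graph) (x : X) : set X := [set y | adj x y].

Definition vertex_transitive (X : graph) : Prop :=
  forall x y : X, exists f : X -> X,
    [/\ bijective f, {mono f : u v / adj u v} & f x = y].

Definition graph_covering (X Y : graph) (f : X -> Y) : Prop :=
  [/\ set_surj setT setT f,
      {homo f : u v / adj u v} &
      forall x, set_bij (neighbors x) (neighbors (f x)) f].

Definition covered_by (Y X : graph) : Prop :=
  exists f : X -> Y, graph_covering f.

Section Glue.
Context (T : topologicalType) (r : T -> T -> Prop).

Definition glue_eq : rel T := fun a b => `[< clos_refl_sym_trans T r a b >].

Lemma glue_eq_refl : reflexive glue_eq.
Proof. by move=> a; apply/asboolP; apply: rst_refl. Qed.

Lemma glue_eq_sym : symmetric glue_eq.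
Proof.
by move=> a b; apply/idP/idP => /asboolP ab; apply/asboolP; apply: rst_sym.
Qed.

Lemma glue_eq_trans : transitive glue_eq.
Proof.
by move=> b a c /asboolP ab /asboolP bc; apply/asboolP; apply: rst_trans ab bc.
Qed.

Definition glue_equiv := EquivRel glue_eq glue_eq_refl glue_eq_sym glue_eq_trans.

Definition glued := {eq_quot glue_equiv}.
HB.instance Definition _ := Topological.copy glued (quotient_topology glued).
HB.instance Definition _ := Quotient.on glued.

Definition glue_class (a : T) : glued := \pi_glued a.

End Glue.

Definition unit_interval (R : realType) : Type := set_type (`[0, 1]%classic : set R).

Section UnitInterval.
Context (R : realType).

HB.instance Definition _ := Topological.on (unit_interval R).

Definition unit_val (t : unit_interval R) : R := set_val t.

Lemma mem_unit0 : (0 : R) \in `[0, 1]%classic.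
Proof. by apply/mem_set; rewrite /= in_itv /= lexx ler01. Qed.

Lemma mem_unit1 : (1 : R) \in `[0, 1]%classic.
Proof. by apply/mem_set; rewrite /= in_itv /= lexx ler01. Qed.

Definition unit0 : unit_interval R := exist _ 0 mem_unit0.
Definition unit1 : unit_interval R := exist _ 1 mem_unit1.

Lemma unit0_neq1 : unit0 != unit1.
Proof. by apply/eqP => /(congr1 unit_val)/eqP; rewrite eq_sym oner_eq0. Qed.

HB.instance Definition _ :=
  isBiPointed.Build (unit_interval R) unit0_neq1.

End UnitInterval.

Definition null_homotopic (R : realType) (T : topologicalType) (x : T)
    (g : {path (unit_interval R) from x to x}) : Prop :=
  exists H : unit_interval R * unit_interval R -> T,
    [/\ continuous H,
        forall s, H (s, zero) = g s,
        forall s, H (s, one) = x &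
        forall t, H (zero, t) = x /\ H (one, t) = x].

Definition simply_connected (R : realType) (T : topologicalType) : Prop :=
  [/\ exists _ : T, True,
      forall x y : T, exists _ : {path (unit_interval R) from x to y}, True &
      forall (x : T) (g : {path (unit_interval R) from x to x}),
        null_homotopic g].

Section Realization.
Context (R : realType) (X : graph).

(** Oriented edges; each edge occurs with both orientations. *)
Definition edge := {e : X * X | adj e.1 e.2}.

Definition graph_part (i : (vertex X + edge)%type) : topologicalType :=
  match i with
  | inl _ => discrete_topology unit
  | inr _ => unit_interval R
  end.

Definition graph_parts : topologicalType := {i & graph_part i}.

Definition part_vertex (x : X) : graph_parts :=
  existT graph_part (inl x) tt.
Definition part_edge (e : edge) (t : unit_interval R) : graph_parts :=
  existT graph_part (inr e) t.

Inductive graph_glue : graph_parts -> graph_parts -> Prop :=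
| glue_source e (t : unit_interval R) :
    unit_val t = 0 -> graph_glue (part_edge e t) (part_vertex (val e).1)
| glue_reverse (e e' : edge) (s t : unit_interval R) :
    val e' = ((val e).2, (val e).1) -> unit_val s + unit_val t = 1 ->
    graph_glue (part_edge e s) (part_edge e' t).

Definition realization : topologicalType := glued graph_glue.

Definition vertex_point (x : X) : realization :=
  glue_class graph_glue (part_vertex x).
Definition edge_point (e : edge) (t : unit_interval R) : realization :=
  glue_class graph_glue (part_edge e t).

(** Lengths are measured along finite concatenations of segments of edges:
    [pl_path B p q l]: there is a piecewise linear path of length [l] from [p]
    to [q] staying inside [B]. *)
Inductive pl_path (B : set realization) :
    realization -> realization -> R -> Prop :=
| pl_nil p : B p -> pl_path B p p 0
| pl_cons e (s t : unit_interval R) q l :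
    (forall w : unit_interval R,
       Num.min (unit_val s) (unit_val t) <= unit_val w <= Num.max (unit_val s) (unit_val t) ->
       B (edge_point e w)) ->
    pl_path B (edge_point e t) q l ->
    pl_path B (edge_point e s) q (`|unit_val s - unit_val t| + l).

(** The length metric of [B]; for [B = setT] it is the geodesic metric of the
    graph. The distance is [+oo] when no path in [B] joins [p] and [q]. *)
Definition intrinsic_dist (B : set realization) (p q : realization) : \bar R :=
  ereal_inf [set l%:E | l in [set l : R | pl_path B p q l]].

(** Closed ball of the realization: of an edge joining two vertices at distance
    exactly [n] from [x], the ball of radius [n] contains only the endpoints. *)
Definition graph_ball (x : X) (r : R) : set realization :=
  [set p | (intrinsic_dist setT (vertex_point x) p <= r%:E)%E].

End Realization.

Definition intrinsically_isometric (R : realType) (X Y : graph)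
    (A : set (realization R X)) (B : set (realization R Y)) : Prop :=
  exists2 f : realization R X -> realization R Y,
    set_bij A B f &
    forall p q, A p -> A q ->
      intrinsic_dist B (f p) (f q) = intrinsic_dist A p q.

Definition locally_graph (R : realType) (r : R) (Y X : graph) : Prop :=
  forall y : Y, exists x : X,
    intrinsically_isometric (graph_ball x r) (graph_ball y r).

Definition LG_rigid (R : realType) (r : R) (X : graph) : Prop :=
  forall Y : graph, locally_graph r Y X -> covered_by Y X.

Section PolygonalComplex.
Context (R : realType) (X : graph) (k : nat).

(** The pair [(x0, [:: x1; ...; xm])] encodes the loop (x0, x1, ..., xm = x0);
    for m = 0 it is the constant loop at x0. *)
Definition simple_loop (c : X * seq X) : bool :=
  [&& path (@adj X) c.1 c.2, last c.1 c.2 == c.1 & uniq c.2].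

Definition cyclic_perm (c d : X * seq X) : Prop :=
  exists n, d.2 = rot n c.2 /\ d.1 = last c.1 d.2.

(** [choose] depends only on the class of [c] under cyclic permutation, so
    exactly one loop is selected in each class. *)
Definition loop_repr (c : X * seq X) : X * seq X :=
  choose (fun d => `[< cyclic_perm c d >]) c.

Definition cell :=
  {c : X * seq X | [&& simple_loop c, (size c.2 <= k)%N & loop_repr c == c]}.

(** A closed disc is presented in polar coordinates: the pair [(s, rho)] is the
    point at angle [2 * pi * s] and distance [rho] from the centre. *)
Definition complex_part (i : option cell) : topologicalType :=
  match i with
  | None => realization R X
  | Some _ => (unit_interval R * unit_interval R)%type
  end.

Definition complex_parts : topologicalType := {i & complex_part i}.

Definition part_graph (p : realization R X) : complex_parts :=
  existT complex_part None p.
Definition part_disc (c : cell) (s rho : unit_interval R) : complex_parts :=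
  existT complex_part (Some c) (s, rho).

(** [glue_edge]: the [j]-th of the [m] equal arcs of the boundary circle runs
    along the edge from x_j to x_(j+1). *)
Inductive complex_glue : complex_parts -> complex_parts -> Prop :=
| glue_angle c rho :
    complex_glue (part_disc c zero rho) (part_disc c one rho)
| glue_centre c s s' :
    complex_glue (part_disc c s zero) (part_disc c s' zero)
| glue_edge (c : cell) x p (j : nat) (e : edge X) (s t : unit_interval R) :
    val c = (x, p) -> (j < size p)%N ->
    val e = (nth x (x :: p) j, nth x (x :: p) j.+1) ->
    unit_val s = (j%:R + unit_val t) / (size p)%:R ->
    complex_glue (part_disc c s one) (part_graph (edge_point e t))
| glue_constant (c : cell) (s : unit_interval R) :
    (val c).2 = [::] ->
    complex_glue (part_disc c s one) (part_graph (vertex_point R (val c).1)).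

Definition polygonal_complex : topologicalType := glued complex_glue.

End PolygonalComplex.

Definition simply_connected_at_scale (R : realType) (k : nat) (X : graph) :
    Prop :=
  simply_connected R (polygonal_complex R X k).

(* Main.v *)
(** Fix a vertex [x0] of [X]. Walks from [x0], up to inserting closed walks of
    length at most [2n], form a graph covering [X] by the endpoint map. Two points
    of a ball of radius [n] of this cover with the same image are joined by walks
    differing by a closed walk of length at most [2n], hence are equal: the cover
    is [n]-locally [X], so by rigidity [X] covers it. The composition is a
    self-covering of [X], injective because it maps balls onto balls and, by
    transitivity, these have equal finite cardinalities. Hence the cover is
    trivial: any two walks from [x0] with the same end are equivalent.

    In the polygonal complex an inserted closed walk is null-homotopic, as it
    decomposes into simple loops. One may therefore choose for each point [p] a
    path [gamma p] from [x0] so that, up to homotopy, transport along any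
    continuous path [q] carries [gamma (q 0)] to [gamma (q 1)]: this is checked
    locally, by contracting stars of vertices in the skeleton, and by pushing the
    cells radially to their boundary or to their centre. On a loop [q] this gives
    [gamma . q ~ gamma], so [q] is null-homotopic. *)

Require Import Defs.
From mathcomp Require Import all_boot all_order all_algebra.
From mathcomp Require Import generic_quotient.
From mathcomp Require Import all_classical all_reals all_analysis.
From mathcomp Require Import homotopy.
From mathcomp Require Import lra zify.
From Stdlib Require Import Relation_Operators.

Set Implicit Arguments.
Unset Strict Implicit.
Unset Printing Implicit Defensive.

Import Order.TTheory GRing.Theory Num.Theory.
Import numFieldNormedType.Exports.

Local Open Scope classical_set_scope.
Local Open Scope ring_scope.

(** * Paths up to homotopy *)

(** The scale [2 * n] comes from the shape of closed balls: an edge whose two ends lie at distance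
    exactly [n] from the centre has no interior point in the ball, so closed walks of length
    [2 * n + 1] are never tested. The bound [1 <= n] admits closed walks of length 2, so that a
    backtrack in the cover returns to its starting vertex. The cover is used only as a graph: no
    continuous path is lifted and no van Kampen theorem intervenes. The section [gamma] is not
    continuous in the point. It is chosen separately over stars and cells, and the choices agree up
    to homotopy on overlaps, which is all that transport needs. Connectedness of the real line
    stands in for subdividing a path by a Lebesgue number. Stars have radius 3/4: any value strictly
    between 1/2 and 1 would let the stars of the vertices cover each edge. The radii 1/3 and 2/3
    likewise leave an annulus in each disc where the two recipes for [gamma] are compared. For
    balls, the delicate point is the intrinsic metric: a piecewise linear path must lift without
    leaving the ball. *)

Section ContinuityTools.
Context {R : realType} {S : topologicalType}.
Implicit Types f g : S -> R.

Lemma cont_cst {T : topologicalType} (a : T) : continuous (fun _ : S => a).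
Proof. by move=> x; exact: cvg_cst. Qed.

Lemma cont_id : continuous (fun x : S => x).
Proof. by move=> x; exact: cvg_id. Qed.

Lemma cont_comp {T U : topologicalType} (f : S -> T) (g : T -> U) :
  continuous f -> continuous g -> continuous (fun x => g (f x)).
Proof. by move=> cf cg x; apply: (continuous_comp (cf x)); exact: cg. Qed.

Lemma cont_pair {T U : topologicalType} (f : S -> T) (g : S -> U) :
  continuous f -> continuous g -> continuous (fun x => (f x, g x)).
Proof. by move=> cf cg x; apply: cvg_pair; [exact: cf|exact: cg]. Qed.

Lemma cont_fst {T U : topologicalType} (f : S -> T * U) :
  continuous f -> continuous (fun x => (f x).1).
Proof. by move=> cf; apply: (cont_comp cf) => x; exact: cvg_fst. Qed.

Lemma cont_snd {T U : topologicalType} (f : S -> T * U) :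
  continuous f -> continuous (fun x => (f x).2).
Proof. by move=> cf; apply: (cont_comp cf) => x; exact: cvg_snd. Qed.

Lemma cont_add f g :
  continuous f -> continuous g -> continuous (fun x => f x + g x).
Proof. by move=> cf cg x; apply: cvgD; [exact: cf|exact: cg]. Qed.

Lemma cont_opp f : continuous f -> continuous (fun x => - f x).
Proof. by move=> cf x; apply: cvgN; exact: cf. Qed.

Lemma cont_mul f g :
  continuous f -> continuous g -> continuous (fun x => f x * g x).
Proof. by move=> cf cg x; apply: cvgM; [exact: cf|exact: cg]. Qed.

Lemma cont_min f g :
  continuous f -> continuous g -> continuous (fun x => Num.min (f x) (g x)).
Proof. by move=> cf cg x; apply: continuous_min; [exact: cf|exact: cg]. Qed.

Lemma cont_max f g :
  continuous f -> continuous g -> continuous (fun x => Num.max (f x) (g x)).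
Proof. by move=> cf cg x; apply: continuous_max; [exact: cf|exact: cg]. Qed.

Lemma open_lt_cont f g :
  continuous f -> continuous g -> open [set x | f x < g x].
Proof.
move=> cf cg.
rewrite (_ : [set _ | _] = (fun x => g x + - f x) @^-1` [set y | 0 < y]).
  apply: open_comp; last exact: open_gt.
  by move=> x _; exact: (cont_add cg (cont_opp cf)).
by apply/seteqP; split=> x /=; rewrite subr_gt0.
Qed.

(** The pasting lemma for the closed sets [u <= 0] and [0 <= u]: at a point where [u] vanishes, both
    branches tend to the same value. *)
Lemma cont_if {T : topologicalType} (u : S -> R) (f g : S -> T) :
  continuous u -> continuous f -> continuous g ->
  (forall x, u x = 0 -> f x = g x) ->
  continuous (fun x => if u x <= 0 then f x else g x).
Proof.
move=> cu cf cg fg x A /= nA.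
have [ux|ux|ux] := ltgtP (u x) 0.
- have : nbhs x [set y | u y < 0].
    by apply: open_nbhs_nbhs; split => //; apply: (@open_lt_cont u (fun=> 0)) => //; exact: cont_cst.
  have : nbhs x (f @^-1` A) by apply: cf; rewrite (ltW ux) in nA.
  by apply: filterS2 => y /= Ay /ltW ->.
- have : nbhs x [set y | 0 < u y].
    by apply: open_nbhs_nbhs; split => //; apply: (@open_lt_cont (fun=> 0) u) => //; exact: cont_cst.
  rewrite leNgt ux /= in nA.
  have : nbhs x (g @^-1` A) by apply: cg.
  by apply: filterS2 => y /= Ay uy; rewrite leNgt uy.
- rewrite ux lexx in nA.
  have nf : nbhs x (f @^-1` A) by apply: cf.
  have ng : nbhs x (g @^-1` A) by apply: cg; rewrite -fg.
  by apply: filterS2 nf ng => y /= fy gy; case: ifP.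
Qed.

Lemma cont_if_le {T : topologicalType} (u v : S -> R) (f g : S -> T) :
  continuous u -> continuous v -> continuous f -> continuous g ->
  (forall x, u x = v x -> f x = g x) ->
  continuous (fun x => if u x <= v x then f x else g x).
Proof.
move=> cu cv cf cg fg.
under [X in continuous X]eq_fun => x do rewrite -subr_le0.
apply: cont_if => //; first exact: cont_add cu (cont_opp cv).
by move=> x /eqP; rewrite subr_eq0 => /eqP; exact: fg.
Qed.

End ContinuityTools.

(* The cases without a bound variable catch the eta-reduced goals, the one
   with [fmap] the unfolded form that [/=] makes of [continuous]. *)
Ltac cont :=
  repeat match goal with
  | |- continuous (fun x => x) => exact: cont_id
  | |- continuous (fun _ => ?a) => exact: cont_cst
  | |- continuous (fun x => (_, _)) => apply: cont_pair
  | |- continuous (fun x => _ + _) => apply: cont_add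
  | |- continuous (fun x => - _) => apply: cont_opp
  | |- continuous (fun x => _ * _) => apply: cont_mul
  | |- continuous (fun x => Num.min _ _) => apply: cont_min
  | |- continuous (fun x => Num.max _ _) => apply: cont_max
  | |- continuous (fun x => fst _) => apply: cont_fst
  | |- continuous (fun x => snd _) => apply: cont_snd
  | |- continuous (Num.min ?a) => refine (@cont_min _ _ (fun _ => a) id _ _)
  | |- continuous (Num.max ?a) => refine (@cont_max _ _ (fun _ => a) id _ _)
  | |- continuous (GRing.add ?a) => refine (@cont_add _ _ (fun _ => a) id _ _)
  | |- continuous (GRing.mul ?a) => refine (@cont_mul _ _ (fun _ => a) id _ _)
  | |- continuous (pair ?a) => refine (@cont_pair _ _ _ (fun _ => a) id _ _)
  | |- continuous GRing.opp => refine (@cont_opp _ _ id _)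
  | |- continuous fst => refine (@cont_fst _ _ _ id _)
  | |- continuous snd => refine (@cont_snd _ _ _ id _)
  | |- continuous id => exact: cont_id
  | H : continuous ?f |- continuous ?f => exact: H
  | |- forall x A, nbhs _ A -> nbhs (fmap ?f (nbhs x)) A => change (continuous f)
  | H : continuous ?f |- continuous (fun x => ?f _) => refine (cont_comp _ H)
  end.

Section Paths.
Context {R : realType}.

Definition clamp (t : R) : R := Num.max 0 (Num.min 1 t).

Lemma clamp_cont : continuous clamp.
Proof. by rewrite /clamp; cont. Qed.

Lemma clamp_le0 t : t <= 0 -> clamp t = 0.
Proof. by rewrite /clamp => t0; apply/max_idPl; rewrite ge_min t0 orbT. Qed.

Lemma clamp_ge1 t : 1 <= t -> clamp t = 1.
Proof. by rewrite /clamp => /min_idPl ->; apply/max_idPr; exact: ler01. Qed.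

Lemma clamp_id t : 0 <= t <= 1 -> clamp t = t.
Proof. by move=> /andP[t0 t1]; rewrite /clamp (min_idPr t1); exact/max_idPr. Qed.

Lemma clamp_itv t : 0 <= clamp t <= 1.
Proof. by rewrite /clamp le_max lexx /= ge_max ler01 ge_min lexx. Qed.

Lemma clamp_ge0 t : 0 <= clamp t. Proof. by case/andP: (clamp_itv t). Qed.
Lemma clamp_le1 t : clamp t <= 1. Proof. by case/andP: (clamp_itv t). Qed.

Lemma clampP t : [\/ t <= 0 /\ clamp t = 0, 0 <= t <= 1 /\ clamp t = t
                 | 1 <= t /\ clamp t = 1].
Proof.
have [t0|t0] := leP t 0; first by constructor 1; rewrite clamp_le0.
have [t1|t1] := leP 1 t; first by constructor 3; rewrite clamp_ge1.
by constructor 2; rewrite clamp_id ?(ltW t0) ?(ltW t1).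
Qed.

(** The affine path from [a] to [b], stopped at its ends. For [F] defined on the line,
    [F (seg a b t)] is the piece of [F] over the interval between [a] and [b], run backwards when
    [b < a]. *)
Definition seg (a b t : R) : R := a + (b - a) * clamp t.

Definition pcat {T : Type} (f g : R -> T) (t : R) : T :=
  if t <= 2^-1 then f (2 * t) else g (2 * t - 1).

Definition pback {T : Type} (f : R -> T) (t : R) : T := f (1 - t).

Section Space.
Context {T : topologicalType}.
Implicit Types f g h : R -> T.

(** Paths are total functions on the line, so reparametrizations carry no proof of membership in the
    unit interval. *)
Definition ppath f := [/\ continuous f, forall t, t <= 0 -> f t = f 0
  & forall t, 1 <= t -> f t = f 1].

(** Homotopy relative to the endpoints of paths [R -> T] that are constant on
    each side of [0, 1]. *)
Definition phom f g := exists H : R * R -> T,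
  [/\ continuous H, forall t, H (0, t) = f t, forall t, H (1, t) = g t
    & forall s t, (t <= 0 -> H (s, t) = f 0) /\ (1 <= t -> H (s, t) = f 1)].

Lemma ppath_cst (a : T) : ppath (fun=> a).
Proof. by split => //; exact: cont_cst. Qed.

Lemma ppath_clamp f t : ppath f -> f (clamp t) = f t.
Proof.
by case=> _ f0 f1; case: (clampP t) => -[Ht ->] //; [rewrite (f0 t)|rewrite (f1 t)].
Qed.

Lemma phom_refl f : ppath f -> phom f f.
Proof.
case=> cf f0 f1; exists (fun z => f z.2); split => //=; first by cont.
by move=> _ t; split=> ht; [rewrite f0|rewrite f1].
Qed.

Lemma phom_ends f g : phom f g -> f 0 = g 0 /\ f 1 = g 1.
Proof.
by move=> [H [_ _ H1 He]]; rewrite -!H1; split; apply/esym; apply He.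
Qed.

Lemma phom_sym f g : phom f g -> phom g f.
Proof.
move=> fg; have [e0 e1] := phom_ends fg; case: fg => H [cH H0 H1 He].
exists (fun z => H (1 - z.1, z.2)); split=> /=; first by cont.
- by move=> t; rewrite subr0.
- by move=> t; rewrite subrr.
- by move=> s t; rewrite -e0 -e1; exact: He.
Qed.

Lemma phom_trans g f h : phom f g -> phom g h -> phom f h.
Proof.
move=> fg; have [e0 e1] := phom_ends fg; case: fg => H [cH H0 H1 He].
move=> [K [cK K0 K1 Ke]].
exists (fun z => if z.1 <= 2^-1 then H (2 * z.1, z.2) else K (2 * z.1 - 1, z.2)).
split=> /=.
- apply: cont_if_le; cont => -[s t] /= ->.
  by rewrite mulfV ?pnatr_eq0 // subrr H1 K0.
- by move=> t; rewrite ifT ?mulr0 // invr_ge0.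
- move=> t; rewrite ifF; first by rewrite mulr1 (_ : 2 - 1 = 1 :> R) //; lra.
  by apply/negbTE; rewrite -ltNge; lra.
- by move=> s t; case: ifP => _; [exact: He|rewrite e0 e1; exact: Ke].
Qed.

Lemma phom_ppathl f g : phom f g -> ppath f.
Proof.
move=> [H [cH H0 _ He]]; split; first last.
- by move=> t t1; rewrite -H0; apply He.
- by move=> t t1; rewrite -H0; apply He.
by rewrite -(_ : (fun t => H (0, t)) = f); [cont|exact/funext].
Qed.

Lemma phom_ppathr f g : phom f g -> ppath g.
Proof. by move=> /phom_sym; exact: phom_ppathl. Qed.

Lemma pcat0 f g : pcat f g 0 = f 0.
Proof. by rewrite /pcat ifT ?mulr0 // invr_ge0. Qed.

Lemma pcat1 f g : pcat f g 1 = g 1.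
Proof.
rewrite /pcat ifF; first by rewrite mulr1 (_ : 2 - 1 = 1 :> R) //; lra.
by apply/negbTE; rewrite -ltNge; lra.
Qed.

Lemma phom_cat f f' g g' :
  f 1 = g 0 -> phom f f' -> phom g g' -> phom (pcat f g) (pcat f' g').
Proof.
move=> fg [H [cH H0 H1 He]] [K [cK K0 K1 Ke]].
exists (fun z => if z.2 <= 2^-1 then H (z.1, 2 * z.2) else K (z.1, 2 * z.2 - 1)).
split=> /=.
- apply: cont_if_le; cont => -[s t] /= ->.
  rewrite mulfV ?pnatr_eq0 // subrr; have [_ ->//] := He s 1.
  by have [-> //] := Ke s 0; rewrite lexx.
- by move=> t; rewrite H0 K0.
- by move=> t; rewrite H1 K1.
- move=> s t; rewrite pcat0 pcat1; split=> ht.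
    by rewrite ifT; [apply He|]; lra.
  by rewrite ifF; [apply Ke|apply/negbTE; rewrite -ltNge]; lra.
Qed.

Lemma ppath_cat f g : f 1 = g 0 -> ppath f -> ppath g -> ppath (pcat f g).
Proof.
by move=> fg /phom_refl pf /phom_refl pg; exact: phom_ppathl (phom_cat fg pf pg).
Qed.


End Space.

Lemma ppath_comp {S T : topologicalType} (F : S -> T) (f : R -> S) :
  continuous F -> ppath f -> ppath (fun t => F (f t)).
Proof. by move=> cF [cf f0 f1]; split; [cont|move=> t /f0 ->|move=> t /f1 ->]. Qed.

Lemma phom_comp {S T : topologicalType} (F : S -> T) (f g : R -> S) :
  continuous F -> phom f g -> phom (fun t => F (f t)) (fun t => F (g t)).
Proof.
move=> cF [H [cH H0 H1 He]]; exists (fun z => F (H z)).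
split; [by cont|by move=> t; rewrite H0|by move=> t; rewrite H1|].
by move=> s t; split=> ht; congr F; apply He.
Qed.

Lemma pcat_comp {S T : Type} (F : S -> T) (f g : R -> S) :
  (fun t => F (pcat f g t)) = pcat (fun t => F (f t)) (fun t => F (g t)).
Proof. by apply/funext => t; rewrite /pcat; case: ifP. Qed.

Lemma ppath_seg a b : ppath (seg a b).
Proof.
have cc := clamp_cont.
split; first by rewrite /seg; cont.
- by move=> t t0; rewrite /seg !clamp_le0.
- by move=> t t1; rewrite /seg !clamp_ge1.
Qed.

Lemma seg0 a b : seg a b 0 = a.
Proof. by rewrite /seg clamp_le0 // mulr0 addr0. Qed.

Lemma seg1 a b : seg a b 1 = b.
Proof. by rewrite /seg clamp_ge1 // mulr1 addrC subrK. Qed.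

Lemma ppath_seg01 {T : topologicalType} (f : R -> T) :
  ppath f -> (fun t => f (seg 0 1 t)) = f.
Proof.
by move=> pf; apply/funext => t; rewrite /seg subr0 mul1r add0r ppath_clamp.
Qed.

(** The straight-line homotopy of the convex plane. The groupoid laws, the square relation and the
    homotopies inside a disc are all images of it under a continuous map. *)
Lemma phom_plane (f g : R -> R * R) :
  ppath f -> ppath g -> f 0 = g 0 -> f 1 = g 1 -> phom f g.
Proof.
move=> [cf f0 f1] [cg g0 g1] e0 e1.
exists (fun z => ((1 - z.1) * (f z.2).1 + z.1 * (g z.2).1,
                  (1 - z.1) * (f z.2).2 + z.1 * (g z.2).2)); split.
- by cont.
- by move=> t /=; rewrite subr0 !mul1r !mul0r !addr0 -surjective_pairing.
- by move=> t /=; rewrite subrr !mul1r !mul0r !add0r -surjective_pairing.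
- move=> s t /=; split=> ht; [rewrite (f0 t) ?(g0 t) // -e0|rewrite (f1 t) ?(g1 t) // -e1];
  by rewrite -!mulrDl subrK !mul1r -surjective_pairing.
Qed.

Lemma phom_line (f g : R -> R) :
  ppath f -> ppath g -> f 0 = g 0 -> f 1 = g 1 -> phom f g.
Proof.
move=> pf pg e0 e1.
have cp : continuous (fun x : R => (x, 0 : R)) by cont.
have c1 : continuous (fun z : R * R => z.1) by cont.
apply: (phom_comp c1 (phom_plane (ppath_comp cp pf) (ppath_comp cp pg) _ _)) => /=.
  by rewrite e0.
by rewrite e1.
Qed.

Section Groupoid.
Context {T : topologicalType}.
Implicit Types f g h : R -> T.

(** Both sides are [F] composed with paths of the line having the same ends, and the line is convex.
    No order of [a], [b], [c] is assumed, so unit and inverse laws are instances: an endpoint is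
    repeated or revisited. *)
Lemma phom_seg (F : R -> T) a b c : continuous F ->
  phom (pcat (fun t => F (seg a b t)) (fun t => F (seg b c t)))
       (fun t => F (seg a c t)).
Proof.
move=> cF; rewrite -(pcat_comp F); apply: (phom_comp cF); apply: phom_line.
- by apply: ppath_cat; rewrite ?seg0 ?seg1 //; exact: ppath_seg.
- exact: ppath_seg.
- by rewrite pcat0 !seg0.
- by rewrite pcat1 !seg1.
Qed.

Lemma phom_id f : ppath f -> phom (pcat f (fun=> f 1)) f.
Proof.
move=> pf; have cf : continuous f by case: pf.
have := @phom_seg f 0 1 1 cf; rewrite ppath_seg01 //.
by rewrite (_ : (fun t => f (seg 1 1 t)) = fun=> f 1) //;
  apply/funext => t; rewrite /seg subrr mul0r addr0.
Qed.

Lemma phom_idl f : ppath f -> phom (pcat (fun=> f 0) f) f.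
Proof.
move=> pf; have cf : continuous f by case: pf.
have := @phom_seg f 0 0 1 cf; rewrite ppath_seg01 //.
by rewrite (_ : (fun t => f (seg 0 0 t)) = fun=> f 0) //;
  apply/funext => t; rewrite /seg subrr mul0r addr0.
Qed.

Lemma pbackE f : ppath f -> pback f = fun t => f (seg 1 0 t).
Proof.
move=> pf; apply/funext => t; rewrite /pback /seg -(ppath_clamp (1 - t)) //.
by case: (clampP t) => -[ht ->]; case: (clampP (1 - t)) => -[ht' ->]; congr f;
  lra.
Qed.

Lemma pback0 f : pback f 0 = f 1. Proof. by rewrite /pback subr0. Qed.
Lemma pback1 f : pback f 1 = f 0. Proof. by rewrite /pback subrr. Qed.

Lemma ppath_back f : ppath f -> ppath (pback f).
Proof.
move=> pf; rewrite pbackE //; have cf : continuous f by case: pf.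
exact: (ppath_comp cf (ppath_seg _ _)).
Qed.

Lemma pbackK f : pback (pback f) = f.
Proof. by apply/funext => t; rewrite /pback subKr. Qed.

Lemma phom_catV f : ppath f -> phom (pcat f (pback f)) (fun=> f 0).
Proof.
move=> pf; have cf : continuous f by case: pf.
have := @phom_seg f 0 1 0 cf; rewrite ppath_seg01 // -pbackE //.
by rewrite (_ : (fun t => f (seg 0 0 t)) = fun=> f 0) //;
  apply/funext => t; rewrite /seg subrr mul0r addr0.
Qed.

Lemma phom_catVl f : ppath f -> phom (pcat (pback f) f) (fun=> f 1).
Proof. by move=> /ppath_back/phom_catV; rewrite pbackK pback0. Qed.

(** Lays [f] on [0, 1] and [g] after it at the same speed, so that consecutive paths become pieces
    of one map, as [phom_seg] requires. *)
Definition join f g t := if t <= 1 then f t else g (t - 1).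

Lemma join_cont f g : continuous f -> continuous g -> f 1 = g 0 ->
  continuous (join f g).
Proof. by move=> cf cg fg; apply: cont_if_le; cont => _ ->; rewrite subrr. Qed.

Lemma joinl f g : ppath f -> (fun t => join f g (seg 0 1 t)) = f.
Proof.
move=> pf; apply/funext => t; rewrite /join /seg subr0 mul1r add0r clamp_le1.
exact: ppath_clamp.
Qed.

Lemma joinr f g a b : f 1 = g 0 -> 0 <= a -> 0 <= b ->
  (fun t => join f g (seg (1 + a) (1 + b) t)) = fun t => g (seg a b t).
Proof.
move=> fg a0 b0; apply/funext => t.
have -> : seg (1 + a) (1 + b) t = 1 + seg a b t by rewrite /seg; lra.
have : 0 <= seg a b t.
  rewrite /seg; have /andP[] := clamp_itv t; nra.
rewrite /join le_eqVlt => /orP[/eqP<-|s0]; first by rewrite addr0 lexx.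
by rewrite gerDl leNgt s0 /= addrC addKr.
Qed.

(** The three paths are pieces of one map [F] over [0, 1], [1, 2] and [2, 3]; each bracketing is
    homotopic to [F] run over [0, 3]. *)
Lemma phom_catA f g h : ppath f -> ppath g -> ppath h ->
  f 1 = g 0 -> g 1 = h 0 ->
  phom (pcat (pcat f g) h) (pcat f (pcat g h)).
Proof.
move=> pf pg ph fg gh.
have cf : continuous f by case: pf.
have cg : continuous g by case: pg.
have ch : continuous h by case: ph.
have jgh0 : f 1 = join g h 0 by rewrite /join ler01.
pose F := join f (join g h).
have cF : continuous F by do 2?[apply: join_cont => //].
have Ef : f = fun t => F (seg 0 1 t) by rewrite joinl.
have Eg : g = fun t => F (seg 1 2 t).
  have := @joinr f (join g h) 0 1 jgh0 (lexx 0) ler01.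
  by rewrite addr0 joinl // => ->.
have Eh : h = fun t => F (seg 2 3 t).
  have := @joinr f (join g h) 1 2 jgh0 ler01 (ler0n _ _).
  have := @joinr g h 0 1 gh (lexx 0) ler01.
  rewrite addr0 ppath_seg01 // => ->.
  by rewrite (_ : 1 + 2 = 3 :> R) //; lra.
have E13 := @phom_seg F 1 2 3 cF; rewrite -Eg -Eh in E13.
have E02 := @phom_seg F 0 1 2 cF; rewrite -Eg -Ef in E02.
have E1 := @phom_seg F 0 1 3 cF; rewrite -Ef in E1.
have E2 := @phom_seg F 0 2 3 cF; rewrite -Eh in E2.
apply: (@phom_trans _ (fun t => F (seg 0 3 t))).
  apply: phom_trans E2; apply: phom_cat => //; last exact: phom_refl.
  by rewrite pcat1.
apply: phom_sym; apply: phom_trans E1; apply: phom_cat => //; last exact: phom_refl.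
by rewrite pcat0.
Qed.

Lemma phom_catKV f g : ppath f -> ppath g -> f 1 = g 0 ->
  phom (pcat (pcat f g) (pback g)) f.
Proof.
move=> pf pg fg.
apply: (phom_trans (phom_catA pf pg (ppath_back pg) fg (esym (pback0 g)))).
apply: (phom_trans _ (phom_id pf)); apply: phom_cat; first by rewrite pcat0.
  exact: phom_refl.
by rewrite fg; exact: phom_catV.
Qed.

Lemma phom_catVK f g : ppath f -> ppath g -> f 1 = g 1 ->
  phom (pcat (pcat f (pback g)) g) f.
Proof.
move=> pf pg fg; rewrite -[X in pcat _ X]pbackK.
by apply: phom_catKV => //; rewrite ?pback0//; exact: ppath_back.
Qed.

Lemma phom_cancelr f g h : ppath f -> ppath g -> ppath h -> f 1 = h 0 ->
  g 1 = h 0 -> phom (pcat f h) (pcat g h) -> phom f g.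
Proof.
move=> pf pg ph fh gh E.
apply: (phom_trans (phom_sym (phom_catKV pf ph fh))).
apply: phom_trans (phom_catKV pg ph gh).
by apply: phom_cat E (phom_refl (ppath_back ph)); rewrite pcat1 pback0.
Qed.

Lemma phom_square (F : R * R -> T) : continuous F ->
  phom (pcat (fun t => F (seg 0 1 t, 0)) (fun t => F (1, seg 0 1 t)))
       (pcat (fun t => F (0, seg 0 1 t)) (fun t => F (seg 0 1 t, 1))).
Proof.
move=> cF.
have [cs _ _] := ppath_seg 0 1.
have p1 (a : R) : ppath (fun t => (seg 0 1 t, a)).
  by apply: (@ppath_comp _ _ (fun x => (x, a))); [cont|exact: ppath_seg].
have p2 (a : R) : ppath (fun t => (a, seg 0 1 t)).
  by apply: (@ppath_comp _ _ (fun x => (a, x))); [cont|exact: ppath_seg].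
rewrite -!(pcat_comp F); apply: (phom_comp cF); apply: phom_plane.
- by apply: ppath_cat; rewrite ?seg0 ?seg1.
- by apply: ppath_cat; rewrite ?seg0 ?seg1.
- by rewrite !pcat0 !seg0.
- by rewrite !pcat1 !seg1.
Qed.

End Groupoid.
End Paths.

(** A class of [E] is open and closed, and the line is connected. *)
Lemma locally_true_equivalence {R : realType} (E : R -> R -> Prop) :
  (forall a b, E a b -> E b a) -> (forall a b c, E a b -> E b c -> E a c) ->
  (forall c, \forall x \near c, E c x) -> forall a b, E a b.
Proof.
move=> sE tE lE a b.
have refl x : E x x by exact: nbhs_singleton (lE x).
have oE : open [set x | E a x].
  rewrite openE => c /= ac; rewrite /interior.
  by apply: filterS (lE c) => x; exact: tE.
have cE : closed [set x | E a x].
  move=> c /(_ _ (lE c)) [x [/= ax cx]]; exact: tE ax (sE _ _ cx).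
have : connected [set: R] by apply/connected_intervalP => x y _ _ z _.
move=> /(_ [set x | E a x]) H; rewrite -[E a b]/([set x | E a x] b) H //.
- by exists a; exact: refl.
- by exists [set x | E a x] => //; rewrite setTI.
- by exists [set x | E a x] => //; rewrite setTI.
Qed.

(** * Transport of a family of paths along a curve *)

Section Parallel.
Context {R : realType} {S T : topologicalType}.
Context (iota : S -> T) (gamma : S -> R -> T).

(** [gamma] is thought of as a section of the path space over [S]; it is
    parallel along [q] when it is carried to itself by transport along [q]. *)
Definition parallel (q : R -> S) :=
  phom (pcat (gamma (q 0)) (fun t => iota (q t))) (gamma (q 1)).

Context (iota_cont : continuous iota).
Context (gamma_path : forall p, ppath (gamma p)).
Context (gamma1 : forall p, gamma p 1 = iota p).

Lemma parallel_seg_trans q a b c : continuous q ->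
  parallel (fun t => q (seg a b t)) -> parallel (fun t => q (seg b c t)) ->
  parallel (fun t => q (seg a c t)).
Proof.
move=> cq; rewrite /parallel !seg0 !seg1 => ab bc.
have cF : continuous (fun t => iota (q t)) by cont.
have pS x y : ppath (fun t => iota (q (seg x y t))).
  exact: (ppath_comp cF (ppath_seg x y)).
have S1 := phom_seg a b c cF.
apply: phom_trans bc.
apply: (@phom_trans _ _ (pcat (gamma (q a)) (pcat (fun t => iota (q (seg a b t)))
  (fun t => iota (q (seg b c t)))))).
  apply: phom_cat; [by rewrite gamma1 seg0|exact: phom_refl|exact: phom_sym].
apply: (@phom_trans _ _ (pcat (pcat (gamma (q a)) (fun t => iota (q (seg a b t))))
  (fun t => iota (q (seg b c t))))).
  apply/phom_sym/phom_catA => //; rewrite ?seg0 ?seg1 ?gamma1 //.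
apply: phom_cat; [by rewrite pcat1 seg0 seg1|exact: ab|exact: phom_refl].
Qed.

Lemma parallel_seg_sym q a b : continuous q ->
  parallel (fun t => q (seg a b t)) -> parallel (fun t => q (seg b a t)).
Proof.
move=> cq; rewrite /parallel !seg0 !seg1 => ab.
have cF : continuous (fun t => iota (q t)) by cont.
have pS x y : ppath (fun t => iota (q (seg x y t))).
  exact: (ppath_comp cF (ppath_seg x y)).
have -> : (fun t => iota (q (seg b a t))) = (pback (fun t => iota (q (seg a b t)))).
  rewrite pbackE //; apply/funext => t; congr (iota (q _)); rewrite /seg.
  by case: (clampP t) => -[ht ->]; rewrite clamp_id; lra.
apply: (phom_trans _ (@phom_catKV _ _ _ (fun t => iota (q (seg a b t))) _ _ _)) => //.
  apply: phom_cat; rewrite ?gamma1 ?pback0 ?seg1 //; first exact: phom_sym.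
  exact: phom_refl (ppath_back (pS _ _)).
by rewrite gamma1 seg0.
Qed.

(** Being parallel along the piece of [q] between two times is an equivalence relation between these
    times. It holds near each time [c], since the piece of [q] from [c] to a close time stays in a
    neighbourhood of [q c]. *)
Lemma locally_parallel :
  (forall p : S, exists2 U : set S, nbhs p U &
    forall q, ppath q -> (forall t, U (q t)) -> parallel q) ->
  forall q, ppath q -> parallel q.
Proof.
move=> loc q pq; have cq : continuous q by case: pq.
suff : forall a b, parallel (fun t => q (seg a b t)).
  by move=> /(_ 0 1); rewrite ppath_seg01.
apply: locally_true_equivalence.
- by move=> a b; exact: parallel_seg_sym.
- by move=> a b c; exact: parallel_seg_trans.
move=> c; have [U nU HU] := loc (q c).
have /nbhs_ballP[e /= e0 be] := cq c U nU.
apply/nbhs_ballP; exists e => //= x bx; apply: HU.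
  exact: (ppath_comp cq (ppath_seg c x)).
move=> t; apply: be; move: bx; rewrite /ball /= /seg => bx.
rewrite opprD addrA subrr sub0r normrN normrM (ger0_norm (clamp_ge0 _)).
rewrite distrC; apply: le_lt_trans bx; apply: ler_piMr => //.
exact: clamp_le1.
Qed.

End Parallel.

(** [F] deforms the path [F (s, 0)] into [F (s, 1)], and each [g] is the corresponding [d] followed
    by the track of the deformation run backwards. Transport of [d0] to [d1] along the deformed path
    then pulls back to the original one. The deformed path will be constant (at a vertex or at the
    centre of a cell) or lie in the skeleton. *)
Lemma parallel_deform {R : realType} {T : topologicalType} (F : R * R -> T)
    (d0 d1 g0 g1 : R -> T) :
  continuous F -> ppath (fun s => F (s, 0)) -> ppath (fun s => F (s, 1)) ->
  ppath d0 -> d0 1 = F (0, 1) -> phom (pcat d0 (fun s => F (s, 1))) d1 ->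
  phom g0 (pcat d0 (pback (fun t => F (0, seg 0 1 t)))) ->
  phom g1 (pcat d1 (pback (fun t => F (1, seg 0 1 t)))) ->
  phom (pcat g0 (fun s => F (s, 0))) g1.
Proof.
move=> cF pF pF1 pd0 d01 d h0 h1.
have [_ dd1] := phom_ends d; rewrite pcat1 in dd1.
have pd1 := phom_ppathr d.
have p0 (a : R) : ppath (fun t => F (a, seg 0 1 t)).
  by apply: (@ppath_comp _ _ _ (fun x : R => F (a, x))); [cont|exact: ppath_seg].
have sq := phom_square cF.
rewrite (ppath_seg01 pF) (ppath_seg01 pF1) in sq.
have [_ e0] := phom_ends h0; have [_ e1] := phom_ends h1.
rewrite !pcat1 !pback1 !seg0 in e0 e1.
have pg0 := phom_ppathl h0; have pg1 := phom_ppathl h1.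
apply: (@phom_cancelr _ _ _ _ (fun t => F (1, seg 0 1 t))) => //.
- exact: ppath_cat.
- by rewrite pcat1 seg0.
- by rewrite seg0.
apply: (@phom_trans _ _ d1); last first.
  apply: phom_sym; apply: (@phom_trans _ _ (pcat (pcat d1
     (pback (fun t => F (1, seg 0 1 t)))) (fun t => F (1, seg 0 1 t)))).
    by apply: phom_cat; [rewrite seg0|exact: h1|exact: phom_refl].
  by apply: phom_catVK => //; rewrite seg1.
apply: phom_trans d.
apply: (phom_trans (phom_catA pg0 pF (p0 1) e0 _)); first by rewrite seg0.
apply: (@phom_trans _ _ (pcat g0 (pcat (fun t => F (0, seg 0 1 t)) (fun s => F (s, 1))))).
  apply: phom_cat; [by rewrite pcat0|exact: phom_refl|exact: sq].
apply: (phom_trans (phom_sym (phom_catA pg0 (p0 0) pF1 _ _))).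
- by rewrite seg0.
- by rewrite seg1.
apply: phom_cat; [by rewrite pcat1 seg1| |exact: phom_refl].
apply: (@phom_trans _ _ (pcat (pcat d0
     (pback (fun t => F (0, seg 0 1 t)))) (fun t => F (0, seg 0 1 t)))).
  by apply: phom_cat; [rewrite seg0|exact: h0|exact: phom_refl].
by apply: phom_catVK => //; rewrite seg1.
Qed.

(** * Gluing and the realization of a graph *)

Section Gluing.
Context (T : topologicalType) (r : T -> T -> Prop).

Lemma glue_class_eq a b : r a b -> glue_class r a = glue_class r b.
Proof.
by move=> ab; apply/eqmodP => /=; apply/asboolP; exact: rst_step.
Qed.

Lemma glued_ind (Q : glued r -> Prop) :
  (forall a, Q (glue_class r a)) -> forall p, Q p.
Proof. by move=> H p; rewrite -[p]reprK; exact: H. Qed.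

Lemma glued_lift {Z : Type} (f : T -> Z) : (forall a b, r a b -> f a = f b) ->
  exists g : glued r -> Z, forall a, g (glue_class r a) = f a.
Proof.
move=> rf; exists (fun p => f (repr p)) => a.
have : glue_eq r (repr (glue_class r a)) a.
  by have /eqmodP := reprK (glue_class r a).
have E x y : clos_refl_sym_trans T r x y -> f x = f y.
  by elim=> [{}x {}y /rf|{}x|{}x {}y _ ->|{}x {}y z _ -> _ ->].
by move=> /asboolP; exact: E.
Qed.

Lemma glued_openP (U : set (glued r)) : open U <-> open (glue_class r @^-1` U).
Proof. by []. Qed.

Lemma glue_class_cont : continuous (glue_class r).
Proof. by apply/continuousP => A; exact: (glued_openP A).1. Qed.

End Gluing.

(** * Final topologies given by charts *)

Section FinalTopology.
Context {R : realType} {J : Type} {Q P : topologicalType}.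
Context (phi : J -> Q -> P).

Definition final_family := [/\ forall j, continuous (phi j),
  forall p, exists j q, phi j q = p &
  forall U : set P, (forall j, open (phi j @^-1` U)) -> open U].

Lemma final_cont {Z : topologicalType} (F : P -> Z) : final_family ->
  (forall j, continuous (fun q => F (phi j q))) -> continuous F.
Proof.
move=> [_ _ fin] cF; apply/continuousP => A oA; apply: fin => j.
by have /continuousP := cF j; apply.
Qed.

(** Whitehead's lemma: [R] is locally compact, so the product of a quotient map
    with [R] is again a quotient map. *)
Lemma final_prod_cont {Z : topologicalType} (F : P * R -> Z) : final_family ->
  (forall j, continuous (fun z : Q * R => F (phi j z.1, z.2))) -> continuous F.
Proof.
move=> [cphi sur fin] cF [p t] A /= nA.
rewrite nbhs_simpl /=; move: nA; rewrite nbhsE => -[U [oO Opt] OA].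
have oW j : open [set z : Q * R | U (F (phi j z.1, z.2))].
  by have /continuousP := cF j; exact.
have [j [q qp]] := sur p.
have /nbhs_ballP[e /= e0 be] : nbhs t [set s | U (F (p, s))].
  have : nbhs (q, t) [set z : Q * R | U (F (phi j z.1, z.2))].
    by apply: open_nbhs_nbhs; split => //=; rewrite qp.
  have ct : continuous (fun s : R => (q, s)) by cont.
  by rewrite -qp => /(ct t); apply.
(* A compact neighbourhood of [t] in the slice over [p]. By the tube lemma, applied in each chart,
   the points whose slice over [K] lies in [U] form an open set [V]. *)
pose K : set R := `[t - e / 2, t + e / 2]%classic.
have cK : compact K by exact: segment_compact.
pose V := [set p' | forall s, K s -> U (F (p', s))].
have oV : open V.
  apply: fin => j'; rewrite openE => q' /= Vq'.
  move/compact_near_coveringP: cK => /(_ Q (nbhs q')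
    (fun q'' s => U (F (phi j' q'', s))) _); apply => s Ks.
  have : nbhs (q', s) [set z : Q * R | U (F (phi j' z.1, z.2))].
    by apply: open_nbhs_nbhs; split => //=; exact: Vq'.
  move=> [[B C] /= [nB nC] BC]; exists (C, B) => // -[c b] /= [Cc Bb].
  exact: (BC (b, c)).
exists (V, K) => /=; last by move=> [p' s] /= [Vp' Ks]; exact/OA/Vp'.
split.
  apply: open_nbhs_nbhs; split => // s; rewrite /K /= in_itv /= => /andP[s1 s2].
  by apply: be; rewrite /ball /= ltr_norml; apply/andP; split; lra.
apply/nbhs_ballP; exists (e / 2) => /=; first by rewrite divr_gt0.
move=> s; rewrite /ball /= ltr_norml /K /= in_itv /= => /andP[s1 s2].
by apply/andP; split; lra.
Qed.

End FinalTopology.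

Section UnitInterval.
Context {R : realType}.

Lemma mem_clamp (t : R) : clamp t \in (`[0, 1]%classic : set R).
Proof. by apply/mem_set; rewrite /= in_itv /=; exact: clamp_itv. Qed.

(** The retraction of the line onto the interval; charts of edges and discs can then be written with
    arbitrary real coordinates. *)
Definition clampI (t : R) : unit_interval R := exist _ (clamp t) (mem_clamp t).

Lemma unit_val_itv (u : unit_interval R) : 0 <= unit_val u <= 1.
Proof. by case: u => u /= uI; have := set_mem uI; rewrite /= in_itv. Qed.

Lemma unit_val_inj : injective (@unit_val R).
Proof. exact: val_inj. Qed.

Lemma clampI_val (u : unit_interval R) : clampI (unit_val u) = u.
Proof. by apply: unit_val_inj; exact: clamp_id (unit_val_itv u). Qed.

Lemma unit_val_clampI t : unit_val (clampI t) = clamp t.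
Proof. by []. Qed.

Lemma unit_val_cont : continuous (@unit_val R).
Proof. exact: initial_continuous. Qed.

Lemma clampI_cont : continuous clampI.
Proof.
move=> t A [B [[W oW WB] Bt] BA].
have : nbhs t (clamp @^-1` W).
  apply: clamp_cont; apply: open_nbhs_nbhs; split => //.
  by move: Bt; rewrite -WB.
by apply: filterS => s /= Ws; apply: BA; rewrite -WB.
Qed.

End UnitInterval.

Section RealizationPoints.
Context {R : realType} {X : graph}.
Local Notation rz := (realization R X).
Local Notation vpt := (vertex_point R).

Definition redge (e : edge X) : edge X :=
  exist (fun z : X * X => is_true (adj z.1 z.2)) ((val e).2, (val e).1)
    (eq_ind _ is_true (valP e) _ (adj_sym _ _)).

Lemma redgeK : involutive redge.
Proof. by move=> e; apply: val_inj; rewrite /= -surjective_pairing. Qed.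

Definition edge_at (e : edge X) (t : R) : rz := edge_point e (clampI t).

Lemma edge_at_clamp e t : edge_at e (clamp t) = edge_at e t.
Proof. by rewrite /edge_at; congr edge_point; exact: (clampI_val (clampI t)). Qed.

Lemma edge_at_le0 e t : t <= 0 -> edge_at e t = vpt (val e).1.
Proof.
by move=> t0; apply: glue_class_eq; constructor; rewrite unit_val_clampI clamp_le0.
Qed.

Lemma edge_at_redge e t : edge_at (redge e) (1 - t) = edge_at e t.
Proof.
apply: esym; apply: glue_class_eq; apply: glue_reverse => //.
rewrite !unit_val_clampI.
by case: (clampP t) => -[ht ->]; case: (clampP (1 - t)) => -[ht' ->]; lra.
Qed.

Lemma edge_at_ge1 e t : 1 <= t -> edge_at e t = vpt (val e).2.
Proof. by move=> t1; rewrite -edge_at_redge edge_at_le0 // subr_le0. Qed.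

Lemma realization_ind (Q : rz -> Prop) :
  (forall x, Q (vpt x)) -> (forall e t, 0 <= t <= 1 -> Q (edge_at e t)) ->
  forall p, Q p.
Proof.
move=> Hv He; apply: glued_ind => -[[x []|e t]]; first exact: Hv.
by have := He e (unit_val t) (unit_val_itv t); rewrite /edge_at clampI_val.
Qed.

Lemma realization_lift {Z : Type} (fv : X -> Z) (fe : edge X -> R -> Z) :
  (forall e, fe e 0 = fv (val e).1) ->
  (forall e t, 0 <= t <= 1 -> fe (redge e) (1 - t) = fe e t) ->
  exists g : rz -> Z, (forall x, g (vpt x) = fv x) /\
    (forall e t, g (edge_at e t) = fe e (clamp t)).
Proof.
move=> f0 fr.
pose f (a : graph_parts R X) : Z := match a with
  | existT (inl x) _ => fv x
  | existT (inr e) t => fe e (unit_val t) end.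
have [a b|g Hg] := @glued_lift _ (@graph_glue R X) _ f.
  case=> [e t t0|e e' s t ee' st] /=; first by rewrite t0.
  have -> : e' = redge e by apply: val_inj; rewrite ee'.
  by rewrite -(fr _ _ (unit_val_itv s)); congr fe; lra.
by exists g; split=> [x|e t]; rewrite Hg.
Qed.

Lemma edge_at_cont e : continuous (edge_at e).
Proof.
apply: (cont_comp clampI_cont); rewrite /edge_point.
apply: (@cont_comp _ _ _ (part_edge e)); last exact: glue_class_cont.
exact: (@existT_continuous _ (@graph_part R X) (inr e)).
Qed.

Lemma realization_openP (U : set rz) :
  (forall e, open (edge_at e @^-1` U)) -> open U.
Proof.
move=> oU; apply/glued_openP/sigT_openP => -[x|e]; first exact: discrete_open.
rewrite (_ : _ @^-1` _ = @unit_val R @^-1` (edge_at e @^-1` U)).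
  by have /continuousP := @unit_val_cont R; apply; exact: oU.
by apply/seteqP; split=> u /=; rewrite /edge_at clampI_val.
Qed.

(** The second coordinate is a dummy: vertices, edges and, later, discs share the chart domain
    [R * R] that [final_family] asks for. *)
Definition rchart (j : X + edge X) (z : R * R) : rz :=
  match j with inl x => vpt x | inr e => edge_at e z.1 end.

Lemma rchart_final : final_family rchart.
Proof.
split.
- case=> [x|e] /=; first exact: cont_cst.
  exact: (cont_comp (cont_fst (@cont_id _)) (@edge_at_cont e)).
- elim/realization_ind => [x|e t _]; first by exists (inl x), (0, 0).
  by exists (inr e), (t, 0).
- move=> U oU; apply: realization_openP => e.
  have c : continuous (fun t : R => (t, 0 : R)) by cont.
  by have /continuousP := c; move=> /(_ _ (oU (inr e))).
Qed.

Lemma realization_deform (kap : edge X -> R * R -> R) :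
  (forall e, continuous (kap e)) -> (forall e s, kap e (0, s) = 0) ->
  (forall e t s, 0 <= t <= 1 -> kap (redge e) (1 - t, s) = 1 - kap e (t, s)) ->
  exists F : rz * R -> rz, [/\ continuous F,
    forall x s, F (vpt x, s) = vpt x &
    forall e t s, F (edge_at e t, s) = edge_at e (kap e (clamp t, s))].
Proof.
move=> ck k0 kr.
have [e|e t t01|g [gv ge]] := @realization_lift _ (fun x (_ : R) => vpt x)
  (fun e t s => edge_at e (kap e (t, s))).
- by apply/funext => s; rewrite k0 edge_at_le0.
- by apply/funext => s; rewrite kr // edge_at_redge.
exists (fun z => g z.1 z.2); split => /=.
- apply: (final_prod_cont rchart_final) => -[x|e] /=.
    by under [X in continuous X]eq_fun => z do rewrite gv; exact: cont_cst.
  under [X in continuous X]eq_fun => z do rewrite ge.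
  have ce := @edge_at_cont e; have cc := @clamp_cont R; have cke := ck e.
  by refine (cont_comp _ ce); refine (cont_comp _ cke); cont.
- by move=> x s; rewrite gv.
- by move=> e t s; rewrite ge.
Qed.

Lemma edge_neq (e : edge X) : (val e).1 != (val e).2.
Proof.
by apply/eqP => ee; have := valP e; rewrite /= ee adj_irrefl.
Qed.

(** On an edge at [v], [d] is the distance to [v]; on every other edge it is 1. [F] acts on the
    whole realization and not only on the star, so that its continuity is checked on charts: it
    collapses the part of each edge within 3/4 of [v], stretches the rest and fixes all vertices.
    The function [k] records the motion inside one edge. *)
Lemma star_contraction (v : X) : exists d : rz -> R, exists F : rz * R -> rz,
  [/\ [/\ continuous d, continuous F & forall p, F (p, 0) = p],
      forall p, d p < 3 / 4 -> F (p, 1) = vpt v,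
      forall e t, 0 <= t <= 1 -> (val e).1 = v -> d (edge_at e t) = t /\
        exists2 k : R -> R, continuous k /\ k 0 = t &
          (t < 3 / 4 -> k 1 = 0) /\ forall s, F (edge_at e t, s) = edge_at e (k s),
      (forall x, d (vpt x) = (x != v)%:R) /\ (forall x s, F (vpt x, s) = vpt x) &
      forall e t, d (edge_at e t) < 3 / 4 -> (val e).1 = v \/ (val e).2 = v].
Proof.
(* Interpolates from the identity to the map that vanishes on [0, 3/4] and is affine from [3/4, 1]
   onto [0, 1]; 0 and 1 are fixed at all times. *)
pose h (z : R * R) := (1 - z.2) * z.1 + z.2 * Num.max 0 (4 * z.1 - 3).
pose kap (e : edge X) (z : R * R) := if (val e).1 == v then h z else
  if (val e).2 == v then 1 - h (1 - z.1, z.2) else z.1.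
pose de (e : edge X) (t : R) := if (val e).1 == v then t else
  if (val e).2 == v then 1 - t else 1.
have ch : continuous h by rewrite /h; cont.
have h0 s : h (0, s) = 0.
  by rewrite /h /= !mulr0 add0r (_ : Num.max _ _ = 0) ?mulr0 //; apply/max_idPl; lra.
have h1 s : h (1, s) = 1.
  by rewrite /h /= (_ : Num.max _ _ = 1); [lra|rewrite (_ : 4 * 1 - 3 = 1 :> R);
    [apply/max_idPr; lra|lra]].
have ck e : continuous (kap e).
  by rewrite /kap; case: ((val e).1 == v); [|case: ((val e).2 == v)]; cont.
have k0 e s : kap e (0, s) = 0.
  by rewrite /kap /= subr0 h0 h1 subrr; do 2?case: ifP.
have kr e t s : 0 <= t <= 1 -> kap (redge e) (1 - t, s) = 1 - kap e (t, s).
  move=> _; rewrite /kap /= subKr; have := edge_neq e.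
  case: (eqVneq (val e).1 v) => [-> |_]; case: (eqVneq (val e).2 v) => [e2|_];
    rewrite ?e2 ?eqxx // => _.
  by rewrite subKr.
have [F [cF Fv Fe]] := realization_deform ck k0 kr.
have [e|e t t01|d [dv dE]] := @realization_lift _ (fun x => (x != v)%:R : R) de.
- by rewrite /de; case: eqP => // _; case: eqP => // _; rewrite subr0.
- rewrite /de /=; have := edge_neq e.
  case: (eqVneq (val e).1 v) => [-> |_]; case: (eqVneq (val e).2 v) => [e2|_];
    rewrite ?e2 ?eqxx // => _.
  by rewrite subKr.
exists d, F; split; [split=> //| | |by [] | ].
- apply: (final_cont rchart_final) => -[x|e] /=; first exact: cont_cst.
  under [X in continuous X]eq_fun => z do rewrite dE.
  have cc := @clamp_cont R.
  by rewrite /de; case: ((val e).1 == v); [|case: ((val e).2 == v)]; cont.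
- elim/realization_ind => [x|e t t01]; first by rewrite Fv.
  rewrite Fe clamp_id // /kap /h /=; congr edge_at.
  by case: ifP => _; [|case: ifP => _]; rewrite ?subr0 ?mul0r ?mul1r ?addr0 // subKr.
- elim/realization_ind => [x|e t t01].
    by rewrite Fv dv; case: eqP => [->//|_] /= lt; exfalso; lra.
  rewrite Fe dE clamp_id // /kap /de /h /= !subrr !mul0r !add0r !mul1r.
  case: eqP => [ev|_] lt.
    by rewrite edge_at_le0 ?ev //; rewrite ge_max lexx /=; lra.
  case: eqP lt => [ev|_] lt; last by exfalso; lra.
  rewrite edge_at_ge1 ?ev // lerBrDr gerDl ge_max lexx /=; lra.
- move=> e t t01 ev; rewrite dE /de ev eqxx clamp_id //; split=> //.
  exists (fun s => h (t, s)); first by split; [cont|rewrite /h /=; lra].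
  split=> [lt|s]; last by rewrite Fe clamp_id // /kap ev eqxx.
  by rewrite /h /= subrr mul0r add0r mul1r; apply/max_idPl; lra.
- move=> e t; rewrite dE /de.
  case: eqP => [|_]; [by left|case: eqP => [|_ lt]; [by right|exfalso; lra]].
Qed.

End RealizationPoints.

(** * Walks and the polygonal complex *)

Section Walks.
Context {R : realType} {X : graph}.
Local Notation rz := (realization R X).
Local Notation vpt := (vertex_point R).
Local Notation ept := (@edge_at R X).

Definition run (x y : X) (t : R) : rz :=
  if insub (x, y) : option (edge X) is Some e then ept e t else vpt x.

Lemma run_val e : run (val e).1 (val e).2 = ept e.
Proof.
by apply/funext => t; rewrite /run -surjective_pairing valK.
Qed.

Lemma run_adj x y : adj x y -> exists2 e : edge X, val e = (x, y) & run x y = ept e.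
Proof.
move=> xy; pose e : edge X := exist (fun z : X * X => is_true (adj z.1 z.2)) (x, y) xy.
by exists e => //; rewrite -run_val.
Qed.

Lemma run_le0 x y t : t <= 0 -> run x y t = vpt x.
Proof. by rewrite /run; case: insubP => // e _ ee t0; rewrite edge_at_le0 // ee. Qed.

(** Unit speed, the [j]-th step occupying [j, j + 1], makes concatenation a shift of time; [wpath]
    rescales the whole to [0, 1]. *)
Fixpoint walk (x : X) (p : seq X) : R -> rz :=
  if p is y :: p' then join (run x y) (walk y p') else fun=> vpt x.

Lemma walk_le0 x p t : t <= 0 -> walk x p t = vpt x.
Proof.
by case: p => [//|y p] t0 /=; rewrite /join (le_trans t0) // run_le0.
Qed.

Lemma walk_cont x p : path (@adj X) x p -> continuous (walk x p).
Proof.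
elim: p x => [|y p IH] x /=; first by move=> _; exact: cont_cst.
move=> /andP[xy yp]; have [e ee ->] := run_adj xy.
apply: join_cont; [exact: edge_at_cont|exact: IH|].
by rewrite walk_le0 // edge_at_ge1 // ee.
Qed.

Lemma walk_ge x p t : path (@adj X) x p -> (size p)%:R <= t ->
  walk x p t = vpt (last x p).
Proof.
elim: p x t => [|y p IH] x t //= /andP[xy yp]; rewrite -natr1 => st.
have [e ee ->] := run_adj xy; rewrite /join.
have p0 : 0 <= (size p)%:R :> R by [].
have [t1|t1] := leP t 1; last by apply: IH => //; lra.
have p00 : (size p)%:R = 0 :> R by lra.
rewrite edge_at_ge1; last by lra.
by case: p p00 {IH yp st p0} => [|z p] /=; [rewrite ee|move/eqP; rewrite pnatr_eq0].
Qed.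

Lemma walk_catl x p q t : path (@adj X) x p -> t <= (size p)%:R ->
  walk x (p ++ q) t = walk x p t.
Proof.
elim: p x t => [|y p IH] x t /=; first by move=> _ t0; rewrite walk_le0.
move=> /andP[xy yp]; rewrite -natr1 => st; rewrite /join.
by case: ifP => // _; apply: IH => //; lra.
Qed.

Lemma walk_catr x p q t : path (@adj X) x p -> (size p)%:R <= t ->
  walk x (p ++ q) t = walk (last x p) q (t - (size p)%:R).
Proof.
elim: p x t => [|y p IH] x t /=; first by rewrite subr0.
move=> /andP[xy yp]; rewrite -natr1 => st; rewrite /join.
have p0 : 0 <= (size p)%:R :> R by [].
have [t1|t1] := leP t 1; last by rewrite IH //; [congr walk; lra|lra].
have [e ee ->] := run_adj xy.
rewrite edge_at_ge1; last by lra.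
rewrite walk_le0; last by lra.
have p00 : (size p)%:R = 0 :> R by lra.
by case: p p00 {IH yp st p0} => [|z p] /=; [rewrite ee|move/eqP; rewrite pnatr_eq0].
Qed.

Lemma walk_nth x p j t : path (@adj X) x p -> (j < size p)%N -> 0 <= t <= 1 ->
  walk x p (j%:R + t) = run (nth x (x :: p) j) (nth x (x :: p) j.+1) t.
Proof.
move=> + + /andP[t0 t1].
elim: p x j => [|y p IH] x [|j] //= /andP[xy yp] jp.
  by rewrite add0r /join t1.
have zj : 0 <= j%:R :> R by [].
rewrite /join -natr1; case: leP => tj.
  (* Time 1 belongs to the first branch of [join], so the start of the second edge is read as the
     end of the first one. *)
  have tt : t = 0 by lra.
  have jj : j%:R = 0 :> R by lra.
  have j0 : j = 0%N by case: (j) jj => // k /eqP; rewrite pnatr_eq0.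
  rewrite tt j0 (run_le0 _ _ (lexx 0)) /=; have [e ee ->] := run_adj xy.
  by rewrite edge_at_ge1 ?ee //; lra.
rewrite (_ : j%:R + 1 + t - 1 = j%:R + t); last by lra.
rewrite IH //; congr run; last exact: set_nth_default.
by case: j {IH zj tj} jp => //= j jp; apply: set_nth_default; exact: ltnW.
Qed.

Definition wpath x p (t : R) : rz := walk x p (seg 0 (size p)%:R t).

Lemma wpath_ppath x p : path (@adj X) x p -> ppath (wpath x p).
Proof. by move=> /walk_cont cw; exact: (ppath_comp cw (ppath_seg _ _)). Qed.

Lemma wpath0 x p : wpath x p 0 = vpt x.
Proof. by rewrite /wpath seg0 walk_le0. Qed.

Lemma wpath1 x p : path (@adj X) x p -> wpath x p 1 = vpt (last x p).
Proof. by move=> xp; rewrite /wpath seg1 walk_ge. Qed.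

Lemma wpath_edge e : wpath (val e).1 [:: (val e).2] = fun t => ept e (seg 0 1 t).
Proof.
apply/funext => t; rewrite /wpath /= /join run_val.
by rewrite /seg subr0 add0r mul1r clamp_le1.
Qed.

Lemma wpath_cat x p q : path (@adj X) x (p ++ q) ->
  phom (pcat (wpath x p) (wpath (last x p) q)) (wpath x (p ++ q)).
Proof.
move=> xpq; have cw := walk_cont xpq; move: (xpq); rewrite cat_path => /andP[xp pq].
have := phom_seg 0 (size p)%:R (size (p ++ q))%:R cw.
have p0 : 0 <= (size p)%:R :> R by [].
have q0 : 0 <= (size q)%:R :> R by [].
rewrite size_cat natrD.
rewrite (_ : (fun t => walk x (p ++ q) (seg 0 (size p)%:R t)) = wpath x p); last first.
  apply/funext => t; rewrite walk_catl // /seg subr0 add0r.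
  by have := clamp_le1 t; nra.
rewrite (_ : (fun t => walk x (p ++ q) (seg _ (_ + _) t)) = wpath (last x p) q).
  by rewrite /wpath size_cat natrD.
apply/funext => t; rewrite walk_catr //; last first.
  by rewrite /seg; have := clamp_ge0 t; nra.
by rewrite /wpath /seg; congr walk; lra.
Qed.

End Walks.

(** * Coordinates and deformations of the polygonal complex *)

Section Complex.
Context {R : realType} {X : graph} {k : nat}.
Local Notation rz := (realization R X).
Local Notation cx := (polygonal_complex R X k).
Local Notation cell := (cell X k).
Local Notation vpt := (vertex_point R).
Local Notation ept := (@edge_at R X).

Definition skel (p : rz) : cx := glue_class (@complex_glue R X k) (part_graph k p).

Definition disc_at (c : cell) (z : R * R) : cx :=
  glue_class (@complex_glue R X k) (part_disc c (clampI z.1) (clampI z.2)).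

Definition boundary (c : cell) (s : R) : rz :=
  walk (val c).1 (val c).2 ((size (val c).2)%:R * s).

Lemma cell_path (c : cell) : path (@adj X) (val c).1 (val c).2.
Proof. by have /and3P[/and3P[]] := valP c. Qed.

Lemma cell_closed (c : cell) : last (val c).1 (val c).2 = (val c).1.
Proof. by have /and3P[/and3P[_ /eqP]] := valP c. Qed.

Lemma boundary_cont c : continuous (boundary c).
Proof.
have := walk_cont (R := R) (cell_path c) => cw.
by refine (cont_comp _ cw); cont.
Qed.

Lemma skel_cont : continuous skel.
Proof.
apply: (@cont_comp _ _ _ (@part_graph R X k)); last exact: glue_class_cont.
exact: (@existT_continuous _ (@complex_part R X k) None).
Qed.

Lemma disc_at_cont c : continuous (disc_at c).
Proof.
apply: (@cont_comp _ _ _ (fun z : R * R => existT (@complex_part R X k) (Some c)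
  (clampI z.1, clampI z.2))); last exact: glue_class_cont.
apply: (@cont_comp _ (unit_interval R * unit_interval R)%type _
  (fun z : R * R => (clampI z.1, clampI z.2)));
  last exact: (@existT_continuous _ (@complex_part R X k) (Some c)).
have cI := @clampI_cont R.
by apply: cont_pair; refine (cont_comp _ cI); cont.
Qed.

Lemma disc_at_clamp c s t : disc_at c (clamp s, clamp t) = disc_at c (s, t).
Proof.
by rewrite /disc_at /=; congr (glue_class _ (part_disc c _ _));
  exact: (clampI_val (clampI _)).
Qed.

Lemma clampI0 (t : R) : t <= 0 -> clampI t = zero.
Proof. by move=> t0; apply: unit_val_inj; rewrite unit_val_clampI clamp_le0. Qed.

Lemma clampI1 (t : R) : 1 <= t -> clampI t = one.
Proof. by move=> t0; apply: unit_val_inj; rewrite unit_val_clampI clamp_ge1. Qed.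

Lemma disc_at_angle c s t rho : s <= 0 -> 1 <= t -> disc_at c (s, rho) = disc_at c (t, rho).
Proof.
move=> s0 t1; apply: glue_class_eq; rewrite /= (clampI0 s0) (clampI1 t1).
exact: glue_angle.
Qed.

Lemma disc_at_centre c s t rho : rho <= 0 -> disc_at c (s, rho) = disc_at c (t, rho).
Proof.
by move=> r0; apply: glue_class_eq; rewrite /= (clampI0 r0); exact: glue_centre.
Qed.


Lemma nat_split (m : nat) (u : R) : (0 < m)%N -> 0 <= u <= m%:R ->
  exists j : nat, exists t : R, [/\ (j < m)%N, 0 <= t <= 1 & u = j%:R + t].
Proof.
case: m => // m _; elim: m => [|m IH] /andP[u0 um].
  by exists 0%N, u; rewrite add0r u0.
have [um1|um1] := leP u m.+1%:R.
  by have [|j [t [jm t01 ->]]] := IH; [rewrite u0|exists j, t; split=> //; exact: ltnW].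
exists m.+1, (u - m.+1%:R); split=> //; last by lra.
by move: um; rewrite -[m.+2%:R]natr1 => um; lra.
Qed.

Lemma disc_at_boundary c s rho : 0 <= s <= 1 -> 1 <= rho ->
  disc_at c (s, rho) = skel (boundary c s).
Proof.
move=> s01 r1; rewrite /disc_at /= (clampI1 r1).
have [xp lx] := (cell_path c, cell_closed c).
case E : (val c) => [x p]; case: (posnP (size p)) => [p0|p0].
  rewrite /boundary E /=; have pn : (val c).2 = [::] by rewrite E; exact: size0nil.
  rewrite E /= in pn; rewrite pn /=; apply: glue_class_eq.
  by have := @glue_constant R X k c (clampI s); rewrite E /= pn; exact.
have [] := @nat_split (size p) ((size p)%:R * s) p0.
  by case/andP: s01 => s0 s1; rewrite mulr_ge0 //= ler_piMr.
move=> j [t [jp t01 st]]; rewrite /boundary E /= st.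
rewrite E /= in xp; rewrite walk_nth //.
have [e ee ->] : exists2 e : edge X, val e = (nth x (x :: p) j, nth x (x :: p) j.+1)
   & run (nth x (x :: p) j) (nth x (x :: p) j.+1) = ept e.
  by apply: run_adj; exact: (pathP x xp).
apply: glue_class_eq; apply: (glue_edge (j := j) E jp ee).
rewrite !unit_val_clampI !clamp_id // -st mulrC mulKf //.
by rewrite pnatr_eq0 -lt0n.
Qed.

Lemma complex_ind (Q : cx -> Prop) :
  (forall p, Q (skel p)) ->
  (forall c s rho, 0 <= s <= 1 -> 0 <= rho <= 1 -> Q (disc_at c (s, rho))) ->
  forall p, Q p.
Proof.
move=> Hg Hc; apply: glued_ind => -[[c|] p]; last exact: Hg.
case: p => s t; have := Hc c _ _ (unit_val_itv s) (unit_val_itv t).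
by rewrite /disc_at /= !clampI_val.
Qed.

Lemma complex_lift {Z : Type} (fg : rz -> Z) (fc : cell -> R -> R -> Z) :
  (forall c rho, 0 <= rho <= 1 -> fc c 0 rho = fc c 1 rho) ->
  (forall c s t, fc c s 0 = fc c t 0) ->
  (forall c s, 0 <= s <= 1 -> fc c s 1 = fg (boundary c s)) ->
  exists g : cx -> Z, (forall p, g (skel p) = fg p) /\
    (forall c z, g (disc_at c z) = fc c (clamp z.1) (clamp z.2)).
Proof.
move=> fa f0 f1.
pose f (a : complex_parts R X k) : Z := match a with
  | existT None p => fg p
  | existT (Some c) z => fc c (unit_val z.1) (unit_val z.2) end.
have [a b|g Hg] := @glued_lift _ (@complex_glue R X k) _ f.
  case=> [c rho|c s s'|c x p j e s t cE jp ee st|c s pn] /=.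
  - exact: (fa _ _ (unit_val_itv rho)).
  - exact: f0.
  - rewrite [unit_val one]/(1 : R) f1 ?unit_val_itv // /boundary cE /=; congr fg.
    have p0 : (size p)%:R != 0 :> R by rewrite pnatr_eq0 -lt0n (leq_ltn_trans _ jp).
    have xp := cell_path c; rewrite cE /= in xp.
    rewrite st mulrC divfK // walk_nth ?unit_val_itv //.
    have -> : run (nth x (x :: p) j) (nth x (x :: p) j.+1) = ept e.
      by rewrite -run_val ee.
    by rewrite /ept clampI_val.
  - by rewrite [unit_val one]/(1 : R) f1 ?unit_val_itv // /boundary pn.
by exists g; split=> [x|e t]; rewrite Hg.
Qed.

Definition cchart (j : (X + edge X) + cell) (z : R * R) : cx :=
  match j with inl i => skel (rchart i z) | inr c => disc_at c z end.

Lemma cchart_final : final_family cchart.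
Proof.
have [c1 s1 f1] := @rchart_final R X; split.
- case=> [i|c] /=; last exact: disc_at_cont.
  have := c1 i; have := skel_cont => H1 H2.
  exact: (cont_comp H2 H1).
- elim/complex_ind => [p|c s t _ _]; last by exists (inr c), (s, t).
  by have [i [z <-]] := s1 p; exists (inl i), z.
- move=> U oU; apply/glued_openP/sigT_openP => -[c|].
    rewrite (_ : _ @^-1` _ = (fun z : unit_interval R * unit_interval R =>
       (unit_val z.1, unit_val z.2)) @^-1` (disc_at c @^-1` U)).
      have cv := @unit_val_cont R.
      have cu : continuous (fun z : unit_interval R * unit_interval R =>
        (unit_val z.1, unit_val z.2)).
        by apply: cont_pair; refine (cont_comp _ cv); cont.
      by have /continuousP := cu; apply; exact: (oU (inr c)).
    by apply/seteqP; split=> -[s t] /=; rewrite /disc_at /= !clampI_val.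
  by apply: f1 => i; exact: (oU (inl i)).
Qed.

(** Only the radius moves, which respects the identification of angles 0 and 1. Fixing radius 0
    respects the centre, and fixing radius 1 matches the identity of the skeleton. *)
Lemma complex_deform (u : R * R -> R) : continuous u ->
  (forall t, u (0, t) = 0) -> (forall t, u (1, t) = 1) ->
  exists F : cx * R -> cx, [/\ continuous F,
    forall p t, F (skel p, t) = skel p &
    forall c s rho t, F (disc_at c (s, rho), t) = disc_at c (s, u (clamp rho, t))].
Proof.
move=> cu u0 u1.
have [c rho _|c s s'|c s s01|g [gv ge]] := @complex_lift _ (fun x (_ : R) => skel x)
  (fun c s rho t => disc_at c (s, u (rho, t))).
- by apply/funext => t; apply: disc_at_angle.
- by apply/funext => t; rewrite u0; exact: disc_at_centre.
- by apply/funext => t; rewrite u1 disc_at_boundary.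
exists (fun z => g z.1 z.2); split => /=.
- apply: (final_prod_cont cchart_final) => -[i|c] /=.
    under [X in continuous X]eq_fun => z do rewrite gv.
    have [c1 _ _] := @rchart_final R X; have := c1 i => H1; have H2 := skel_cont.
    by refine (cont_comp _ H2); refine (cont_comp _ H1); cont.
  under [X in continuous X]eq_fun => z do rewrite ge.
  have cd := disc_at_cont (c := c); have cc := @clamp_cont R.
  refine (cont_comp _ cd); apply: cont_pair; first by refine (cont_comp _ cc); cont.
  refine (cont_comp _ cu); apply: cont_pair; last by cont.
  by refine (cont_comp _ cc); cont.
- by move=> x s; rewrite gv.
- by move=> c s rho t; rewrite ge /= -disc_at_clamp clamp_id ?clamp_itv // disc_at_clamp.
Qed.

Lemma radius_exists : exists rad : cx -> R, [/\ continuous rad,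
  forall p, rad (skel p) = 1 & forall c z, rad (disc_at c z) = clamp z.2].
Proof.
have [//|//|//|g [gv ge]] := @complex_lift _ (fun _ => 1 : R) (fun _ _ rho => rho).
exists g; split=> //; apply: (final_cont cchart_final) => -[i|c] /=.
  by under [X in continuous X]eq_fun => z do rewrite gv; exact: cont_cst.
under [X in continuous X]eq_fun => z do rewrite ge.
by have cc := @clamp_cont R; refine (cont_comp _ cc); cont.
Qed.


End Complex.

(** * Equivalence of walks *)

Section PathAlgebra.
Context {R : realType} {T : topologicalType}.
Implicit Types f g : R -> T.

Lemma phom_cstl f a : ppath f -> a = f 0 -> phom (pcat (fun=> a) f) f.
Proof. by move=> pf ->; exact: phom_idl. Qed.

Lemma phom_catl f f' g : ppath g -> f 1 = g 0 -> phom f f' ->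
  phom (pcat f g) (pcat f' g).
Proof. by move=> pg fg ff; apply: phom_cat => //; exact: phom_refl. Qed.

Lemma phom_catr f g g' : ppath f -> f 1 = g 0 -> phom g g' ->
  phom (pcat f g) (pcat f g').
Proof. by move=> pg fg ff; apply: phom_cat => //; exact: phom_refl. Qed.

(** Being null-homotopic does not depend on the base point of a loop; needed because cells are
    attached along one chosen rotation of each simple loop. *)
Lemma phom_swap f g : ppath f -> ppath g -> f 1 = g 0 -> g 1 = f 0 ->
  phom (pcat f g) (fun=> f 0) -> phom (pcat g f) (fun=> g 0).
Proof.
move=> pf pg fg gf E.
have E' : phom f (pback g).
  apply: (@phom_cancelr _ _ _ _ g) => //; rewrite ?pback1 //.
    exact: ppath_back.
  by apply: (phom_trans E); rewrite -gf; exact: phom_sym (phom_catVl pg).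
apply: (phom_trans (phom_catr pg gf E')); exact: phom_catV.
Qed.

Lemma phom_cancell f g : ppath f -> ppath g -> f 1 = g 0 ->
  phom (pcat f g) f -> phom g (fun=> g 0).
Proof.
move=> pf pg fg E; have pbf := ppath_back pf.
have e : g 1 = g 0 by have [_] := phom_ends E; rewrite pcat1 fg.
apply: (phom_trans (phom_sym (phom_cstl pg fg))).
apply: (phom_trans (phom_catl pg _ (phom_sym (phom_catVl pf)))) => //.
apply: (phom_trans (phom_catA pbf pf pg _ fg)); first by rewrite pback1.
apply: (phom_trans (phom_catr pbf _ E)); first by rewrite pback1 pcat0.
by rewrite -fg; exact: phom_catVl.
Qed.

End PathAlgebra.

Section WalkEquivalence.
Context {X : graph} (k : nat) (x0 : X).

(** The inserted closed walk need not be simple; for [k] at least 2 it may be a backtrack along one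
    edge. *)
Definition insertion (p q : seq X) : Prop := exists p1 c p2,
  [/\ p = p1 ++ p2, q = p1 ++ c ++ p2, path (@adj X) (last x0 p1) c,
      last (last x0 p1) c = last x0 p1 & (size c <= k)%N].

Definition walk_equiv := clos_refl_sym_trans (seq X) insertion.

Lemma insertion_walk p q : insertion p q ->
  path (@adj X) x0 p = path (@adj X) x0 q /\ last x0 p = last x0 q.
Proof.
move=> [p1 [c [p2 [-> -> pc lc _]]]].
by rewrite !cat_path !last_cat lc pc.
Qed.

Lemma walk_equiv_walk p q : walk_equiv p q ->
  path (@adj X) x0 p = path (@adj X) x0 q /\ last x0 p = last x0 q.
Proof.
elim=> [{}p {}q /insertion_walk //|//|{}p {}q _ [-> ->]//|{}p {}q r _ [-> ->] _ [-> ->] //].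
Qed.

Lemma walk_equiv_catr p q s : walk_equiv p q -> walk_equiv (p ++ s) (q ++ s).
Proof.
elim=> [{}p {}q|{}p|{}p {}q _ h|{}p {}q r _ h _ h'].
- move=> [p1 [c [p2 [-> -> pc lc sc]]]]; apply: rst_step.
  by exists p1, c, (p2 ++ s); rewrite !catA.
- exact: rst_refl.
- exact: rst_sym.
- exact: rst_trans h h'.
Qed.

End WalkEquivalence.

(** On closed walks [cyclic_perm] is reflexive, symmetric and transitive, so a loop and its
    representative define the same predicate for [choose]. Closedness lets the base point be
    recovered from the last entry. Hence every short simple loop is a rotation of one that carries a
    cell. *)
Lemma loop_repr_spec (X : graph) (c : X * seq X) : last c.1 c.2 = c.1 ->
  cyclic_perm c (loop_repr c) /\ loop_repr (loop_repr c) = loop_repr c.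
Proof.
move=> lc.
have trans (a b d : X * seq X) : cyclic_perm a b -> cyclic_perm b d -> cyclic_perm a d.
  move=> [n [b2 b1]] [m [d2 d1]].
  have [i Ei] : exists i, rot m (rot n a.2) = rot i a.2.
    have [nm|nm] := leqP n (size a.2); last first.
      by exists m; rewrite (rot_oversize (ltnW nm)).
    have [mm|mm] := leqP m (size a.2); last first.
      by exists n; rewrite [LHS]rot_oversize // size_rot ltnW.
    by rewrite rot_add_mod //; eexists.
  exists i; rewrite d2 b2 Ei; split => //; rewrite d1 d2 b2 Ei b1.
  case E : (rot i a.2) => [|y s] //=.
  have /size0nil E0 : size a.2 = 0%N by rewrite -(size_rot i) E.
  by rewrite b2 E0.
have sym (a b : X * seq X) : last a.1 a.2 = a.1 -> cyclic_perm a b -> cyclic_perm b a.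
  move=> la [n [b2 b1]]; exists (size b.2 - n)%N; rewrite b2 size_rot.
  have E : rot (size a.2 - n) (rot n a.2) = a.2.
    by have := rotK n a.2; rewrite /rotr size_rot.
  split; first by rewrite E.
  case Ea : a.2 => [|y s]; last by rewrite -la Ea.
  by rewrite b1 b2 Ea /= -[in LHS]la Ea.
have P0 : `[< cyclic_perm c c >].
  by apply/asboolP; exists 0%N; rewrite rot0.
have /asboolP Pr : `[< cyclic_perm c (loop_repr c) >].
  exact: (@chooseP _ (fun d => `[< cyclic_perm c d >]) c P0).
split=> //; rewrite {1}/loop_repr.
have E : (fun d => `[< cyclic_perm (loop_repr c) d >]) =1 (fun d => `[< cyclic_perm c d >]).
  move=> d; apply/asboolP/asboolP; first exact: trans.
  by apply: trans; exact: sym.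
rewrite (eq_choose E) /loop_repr; apply: choose_id => //.
by apply/asboolP.
Qed.

(** * Null homotopy of short closed walks *)

Section ClosedWalks.
Context {R : realType} {X : graph} {k : nat}.
Local Notation rz := (realization R X).
Local Notation cx := (polygonal_complex R X k).
Local Notation cell := (cell X k).
Local Notation vpt := (vertex_point R).
Local Notation skel := (@skel R X k).

Definition cwalk (x : X) p (t : R) : cx := skel (wpath x p t).

Lemma cwalk_ppath x p : path (@adj X) x p -> ppath (cwalk x p).
Proof. by move=> /(wpath_ppath (R := R)); exact: (ppath_comp (@skel_cont R X k)). Qed.

Lemma cwalk0 x p : cwalk x p 0 = skel (vpt x).
Proof. by rewrite /cwalk wpath0. Qed.

Lemma cwalk1 x p : path (@adj X) x p -> cwalk x p 1 = skel (vpt (last x p)).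
Proof. by move=> xp; rewrite /cwalk wpath1. Qed.

Lemma cwalk_cat x p q : path (@adj X) x (p ++ q) ->
  phom (pcat (cwalk x p) (cwalk (last x p) q)) (cwalk x (p ++ q)).
Proof.
move=> /(wpath_cat (R := R)) /(phom_comp (@skel_cont R X k)).
by rewrite pcat_comp.
Qed.

Lemma cwalk_insert x p1 p2 p3 : path (@adj X) x (p1 ++ p2 ++ p3) ->
  last (last x p1) p2 = last x p1 ->
  phom (cwalk (last x p1) p2) (fun=> skel (vpt (last x p1))) ->
  phom (cwalk x (p1 ++ p2 ++ p3)) (cwalk x (p1 ++ p3)).
Proof.
move=> xp l2 h2; have := xp; rewrite !cat_path l2 => /and3P[xp1 xp2 xp3].
have c1 := cwalk_ppath xp1; have c3 := cwalk_ppath xp3.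
have x23 : path (@adj X) (last x p1) (p2 ++ p3) by rewrite cat_path xp2 l2.
have x13 : path (@adj X) x (p1 ++ p3) by rewrite cat_path xp1.
apply: (phom_trans _ (cwalk_cat x13)).
apply: (phom_trans (phom_sym (cwalk_cat xp))).
apply: phom_catr; rewrite ?cwalk0 ?cwalk1 //.
have := cwalk_cat x23; rewrite l2 => E.
apply: (phom_trans (phom_sym E)).
apply: (phom_trans (phom_catl c3 _ h2)); first by rewrite cwalk0 cwalk1 ?l2.
by apply: phom_cstl; rewrite ?cwalk0.
Qed.

(** In the polar square, the side of radius 1 is homotopic to the other three sides. Of these, the
    one of radius 0 is constant in the disc, and the sides of angle 0 and 1 are the same radius run
    inwards and outwards. *)
Lemma cell_null (c : cell) :
  phom (cwalk (val c).1 (val c).2) (fun=> skel (vpt (val c).1)).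
Proof.
have cd := disc_at_cont (R := R) (c := c).
have E : cwalk (val c).1 (val c).2 = fun t => disc_at c (seg 0 1 t, 1).
  apply/funext => t; rewrite /cwalk /wpath -/(boundary _ _).
  rewrite /seg !subr0 !add0r mul1r disc_at_boundary ?clamp_itv //.
pose A (t : R) : R * R := (0, seg 1 0 t).
pose M (t : R) : R * R := (seg 0 1 t, 0).
pose B (t : R) : R * R := (1, seg 0 1 t).
have pA : ppath A.
  by apply: (@ppath_comp _ _ _ (fun x : R => (0 : R, x))); [cont|exact: ppath_seg].
have pM : ppath M.
  by apply: (@ppath_comp _ _ _ (fun x : R => (x, 0 : R))); [cont|exact: ppath_seg].
have pB : ppath B.
  by apply: (@ppath_comp _ _ _ (fun x : R => (1 : R, x))); [cont|exact: ppath_seg].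
have H : phom (fun t => (seg 0 1 t, 1 : R)) (pcat (pcat A M) B).
  apply: phom_plane; rewrite ?pcat0 ?pcat1 /A /B ?seg0 ?seg1 //.
    by apply: (@ppath_comp _ _ _ (fun x : R => (x, 1 : R))); [cont|exact: ppath_seg].
  apply: ppath_cat => //; first by rewrite pcat1 /M seg1 /B seg0.
  by apply: ppath_cat => //; rewrite /M /A seg0 seg1.
have {H} := phom_comp cd H; rewrite -E !pcat_comp => H.
apply: (phom_trans H).
have EM : (fun t => disc_at (R := R) c (M t)) = fun=> disc_at c (A 1).
  by apply/funext => t; rewrite /M /A seg1; exact: disc_at_centre.
have EB : (fun t => disc_at (R := R) c (B t)) = pback (fun t => disc_at c (A t)).
  rewrite pbackE; last exact: ppath_comp cd pA.
  apply/funext => t; rewrite /A /B -(disc_at_angle _ _ (lexx 0) (lexx 1)).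
  congr (disc_at _ (_, _)); rewrite /seg.
  by case: (clampP t) => -[ht ->]; rewrite clamp_id; lra.
have pA' := ppath_comp cd pA.
have -> : skel (vpt (val c).1) = disc_at c (A 0).
  rewrite /A seg0 disc_at_boundary ?lexx ?ler01 // /boundary mulr0.
  by rewrite walk_le0.
rewrite EM EB; apply: (phom_trans _ (phom_catV pA')).
apply: phom_catl; first exact: ppath_back.
  by rewrite pcat1 pback0.
exact: phom_id.
Qed.

Lemma simple_loop_null x p : simple_loop (x, p) -> (size p <= k)%N ->
  phom (cwalk x p) (fun=> skel (vpt x)).
Proof.
move=> sl sp; have /and3P[/= xp /eqP lx up] := sl.
have [[n [E2 E1]] rr] := loop_repr_spec (c := (x, p)) lx; rewrite /= in E1 E2.
set d := loop_repr (x, p) in E1 E2 rr.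
(* The cell is attached along [p2 ++ p1], based at the end of [p1]; [phom_swap] brings its
   contraction back to [p1 ++ p2]. *)
pose p1 := take n p; pose p2 := drop n p.
have Ep : p = p1 ++ p2 by rewrite cat_take_drop.
have Ed : d.2 = p2 ++ p1 by rewrite E2.
have lp2 : last x p2 = x.
  move: lx; rewrite Ep last_cat; case: (p2) => //=.
have lp2' : last (last x p1) p2 = x by rewrite -last_cat -Ep.
have {}E1 : d.1 = last x p1 by rewrite E1 Ed last_cat lp2.
have xp1 : path (@adj X) x p1 by move: xp; rewrite Ep cat_path => /andP[].
have xp2 : path (@adj X) (last x p1) p2 by move: xp; rewrite Ep cat_path => /andP[].
have yp : path (@adj X) (last x p1) (p2 ++ p1) by rewrite cat_path xp2 lp2'.
have dP : [&& simple_loop d, (size d.2 <= k)%N & loop_repr d == d].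
  rewrite rr eqxx andbT /simple_loop E1 Ed yp last_cat lp2' eqxx /=.
  by rewrite size_cat addnC -size_cat -Ep sp uniq_catC -Ep up.
pose c : cell := exist (fun c : X * seq X =>
  is_true [&& simple_loop c, (size c.2 <= k)%N & loop_repr c == c]) d dP.
have := cell_null c; rewrite /= E1 Ed => H.
have := cwalk_cat yp; rewrite lp2' => H2.
rewrite Ep; have := xp; rewrite {1}Ep => /cwalk_cat H3.
apply: (phom_trans (phom_sym H3)).
have -> : skel (vpt x) = cwalk x p1 0 by rewrite cwalk0.
apply: phom_swap; rewrite ?cwalk0 ?cwalk1 ?lp2' //; try exact: cwalk_ppath.
exact: phom_trans H2 H.
Qed.

(** Induction on the length: a repeated vertex splits off a closed subwalk, and both this subwalk
    and the remaining walk are strictly shorter. *)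
Lemma closed_walk_null x p : path (@adj X) x p -> last x p = x ->
  (size p <= k)%N -> phom (cwalk x p) (fun=> skel (vpt x)).
Proof.
have [m] := ubnP (size p); elim: m x p => // m IH x p pm xp lx pk.
case up : (uniq p).
  by apply: simple_loop_null => //; rewrite /simple_loop /= xp lx eqxx.
have /(uniqPn x)[i [j [ij jp Eij]]] := negbT up.
(* Since [p] omits the initial vertex, [p1] must have length [i + 1] to end at the first occurrence;
   [p2] then leads to the second one. *)
pose p1 := take i.+1 p; pose p2 := take (j - i) (drop i.+1 p); pose p3 := drop j.+1 p.
have Ep : p = p1 ++ p2 ++ p3.
  rewrite /p3 (_ : j.+1 = (j - i) + i.+1)%N; last by rewrite addnS subnK // ltnW.
  by rewrite -drop_drop cat_take_drop cat_take_drop.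
have s1 : size p1 = i.+1 by rewrite size_take (leq_ltn_trans ij jp).
have s2 : size p2 = (j - i)%N.
  rewrite size_take size_drop; case: ltnP => //.
  by move=> h; clear -ij jp h; move: (size p) jp h => n jp h; lia.
have l1 : last x p1 = nth x p i.
  by rewrite (last_nth x) s1 /= /p1 nth_take.
have l2 : last (last x p1) p2 = last x p1.
  rewrite l1 Eij (last_nth x) s2.
  have ji : (j - i)%N = (j - i.+1).+1 by rewrite subnSK.
  rewrite ji /= /p2 nth_take -?ji // nth_drop; congr nth.
  by rewrite subnKC.
have := xp; rewrite {1}Ep !cat_path l2 => /and3P[xp1 xp2 xp3].
rewrite Ep; apply: (@phom_trans _ _ (cwalk x (p1 ++ p3))).
  apply: cwalk_insert => //; first by rewrite -Ep.
  have sp : (size p2 < size p)%N by rewrite s2; clear -ij jp; move: (size p) jp => n jp; lia.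
  by apply: IH => //; [exact: leq_trans sp pm|exact: leq_trans (ltnW sp) pk].
have sp : (size (p1 ++ p3) < size p)%N.
  by rewrite Ep !size_cat s2; clear -ij; lia.
apply: IH.
- exact: leq_trans sp pm.
- by rewrite cat_path xp1.
- by move: lx; rewrite {1}Ep !last_cat l2.
- exact: leq_trans (ltnW sp) pk.
Qed.

Lemma walk_equiv_phom x p q : walk_equiv k x p q -> path (@adj X) x p ->
  phom (cwalk x p) (cwalk x q).
Proof.
elim=> [{}p {}q pq|{}p|{}p {}q pq h xq|{}p {}q r pq h qr h' xp].
- have [Epq _] := insertion_walk pq; rewrite Epq.
  case: pq => p1 [c [p2 [-> -> pc lc sc]]] xp; apply: phom_sym.
  by apply: cwalk_insert => //; exact: closed_walk_null.
- by move=> xp; apply: phom_refl; exact: cwalk_ppath.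
- by apply/phom_sym/h; have [->] := walk_equiv_walk pq.
- by apply: (phom_trans (h xp)); apply: h'; have [<-] := walk_equiv_walk pq.
Qed.

End ClosedWalks.

(** * Parallel sections *)

Section SkeletonSection.
Context {R : realType} {X : graph} {k : nat} (x0 : X).
Local Notation rz := (realization R X).
Local Notation cx := (polygonal_complex R X k).
Local Notation vpt := (vertex_point R).
Local Notation skel := (@skel R X k).
Local Notation ept := (@edge_at R X).

Context (walks_equiv : forall p q, path (@adj X) x0 p -> path (@adj X) x0 q ->
  last x0 p = last x0 q -> walk_equiv k x0 p q).

Lemma vertex_section : exists g : X -> R -> cx,
  (forall v, [/\ ppath (g v), g v 0 = skel (vpt x0) & g v 1 = skel (vpt v)]) /\
  (forall e, phom (pcat (g (val e).1) (fun t => skel (ept e (seg 0 1 t))))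
                  (g (val e).2)).
Proof.
have /choice[p pP] : forall v, exists p, path (@adj X) x0 p /\ last x0 p = v.
  by move=> v; have [p xp lp] := graph_connected x0 v; exists p.
exists (fun v => cwalk x0 (p v)); split=> [v|e].
  have [xp lp] := pP v; split; [exact: cwalk_ppath|exact: cwalk0|].
  by rewrite cwalk1 ?lp.
have [xp1 lp1] := pP (val e).1; have [xp2 lp2] := pP (val e).2.
have xpe : path (@adj X) x0 (p (val e).1 ++ [:: (val e).2]).
  by rewrite cat_path xp1 lp1 /= andbT; exact: (valP e).
have := cwalk_cat (R := R) (k := k) xpe; rewrite lp1 /cwalk wpath_edge => E.
apply: (phom_trans E); apply: walk_equiv_phom => //.
by apply: walks_equiv => //; rewrite last_cat lp2.
Qed.

(** Over the star of a vertex, the contraction turns any path into a constant one, so the section is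
    parallel there. Two stars containing the same point are compared inside an edge, through the
    section [arc] that starts at the source of this edge. *)
Lemma skeleton_section : exists gamma : rz -> R -> cx,
  [/\ forall p, ppath (gamma p), forall p, gamma p 0 = skel (vpt x0),
      forall p, gamma p 1 = skel p &
      forall q, ppath q -> parallel skel gamma q].
Proof.
have cs : continuous skel := @skel_cont R X k.
have [g [gP ge]] := vertex_section.
have pg v : ppath (g v) by have [] := gP v.
have g0 v : g v 0 = skel (vpt x0) by have [] := gP v.
have g1 v : g v 1 = skel (vpt v) by have [] := gP v.
have /choice[d /choice[F FP]] := @star_contraction R X.
have cF v : continuous (F v) by have [[]] := FP v.
have F0 v p : F v (p, 0) = p by have [[_ _ ->]] := FP v.
have F1 v p : d v p < 3 / 4 -> F v (p, 1) = vpt v by have [_ + _ _ _] := FP v; apply.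
pose tr v p (t : R) : cx := skel (F v (p, seg 0 1 t)).
have ptr v p : ppath (tr v p).
  apply: (@ppath_comp _ _ _ (fun s : R => skel (F v (p, s)))); last exact: ppath_seg.
  by refine (cont_comp _ cs); refine (cont_comp _ (cF v)); cont.
have tr0 v p : tr v p 0 = skel p by rewrite /tr seg0 F0.
have tr1 v p : d v p < 3 / 4 -> tr v p 1 = skel (vpt v).
  by move=> dp; rewrite /tr seg1 F1.
(* On the star of [v], go to [v] and then back along the contraction to [p]. *)
pose del v p := pcat (g v) (pback (tr v p)).
have pdel v p : d v p < 3 / 4 -> ppath (del v p).
  by move=> dp; apply: ppath_cat => //; [rewrite g1 pback0 tr1|exact: ppath_back].
pose arc e t := pcat (g (val e).1) (fun s => skel (ept e (seg 0 t s))).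
have pe (e : edge X) a b : ppath (fun s => skel (ept e (seg a b s))).
  apply: (ppath_comp (F := fun t => skel (ept e t))); last exact: ppath_seg.
  by have ce := @edge_at_cont R X e; refine (cont_comp _ cs).
have L1 e t : 0 <= t <= 1 -> t < 3 / 4 ->
    phom (del (val e).1 (ept e t)) (arc e t).
  move=> t01 t34; have [_ _ /(_ e t t01 erefl)[_ [h [ch h0] [h1 hF]]] _ _] := FP (val e).1.
  apply: phom_cat; [|exact: phom_refl|].
    by rewrite g1 pback0 tr1 //; have [_ _ /(_ e t t01 erefl)[-> _] _ _] := FP (val e).1.
  rewrite (_ : pback _ = fun s => skel (ept e (pback (fun s => h (seg 0 1 s)) s))); last first.
    by apply/funext => s; rewrite /pback /tr hF.
  have ce := @edge_at_cont R X e.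
  have c2 : continuous (fun t => skel (ept e t)) by refine (cont_comp _ cs).
  apply: (phom_comp c2); apply: phom_line.
  - by apply: ppath_back; exact: (ppath_comp ch (ppath_seg _ _)).
  - exact: ppath_seg.
  - by rewrite pback0 seg1 seg0 h1.
  - by rewrite pback1 seg1 seg0 h0.
(* Reaching a point of the edge from its target or from its source is the same, because [ge] carries
   the chosen path of one end to that of the other. *)
have L2 e t : phom (arc (redge e) (1 - t)) (arc e t).
  have c2 : continuous (fun t => skel (ept e t)).
    by have ce := @edge_at_cont R X e; refine (cont_comp _ cs).
  rewrite /arc (_ : (fun s => _) = fun s => skel (ept e (seg 1 t s))); last first.
    apply/funext => s; rewrite -[in RHS]edge_at_redge; congr (skel (ept _ _)).
    by rewrite /seg; lra.
  have H := phom_seg 0 1 t c2.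
  apply: (@phom_trans _ _ (pcat (g (val e).1) (pcat (fun s => skel (ept e (seg 0 1 s)))
    (fun s => skel (ept e (seg 1 t s)))))); last first.
    by apply: phom_catr => //; rewrite g1 pcat0 seg0 edge_at_le0.
  apply: (@phom_trans _ _ (pcat (pcat (g (val e).1) (fun s => skel (ept e (seg 0 1 s))))
    (fun s => skel (ept e (seg 1 t s))))); last first.
    by apply: phom_catA; rewrite // ?g1 ?seg0 ?seg1 // edge_at_le0.
  apply: phom_catl => //; last exact: phom_sym.
  by rewrite g1 seg0 edge_at_ge1.
have L3 e t v : 0 <= t <= 1 -> d v (ept e t) < 3 / 4 ->
    phom (del v (ept e t)) (arc e t).
  move=> t01 dt; have [_ _ dE _ /(_ e t dt)[ev|ev]] := FP v.
    by move: dt; have [-> _] := dE e t t01 ev; rewrite -ev; exact: L1.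
  move: dt; rewrite -edge_at_redge; have t01' : 0 <= 1 - t <= 1 by lra.
  have [-> _] := dE (redge e) (1 - t) t01' ev => dt.
  apply: phom_trans (L2 e t); rewrite -ev.
  by have := @L1 (redge e) (1 - t) t01' dt.
have compat v w p : d v p < 3 / 4 -> d w p < 3 / 4 -> phom (del v p) (del w p).
  move: p; apply: realization_ind => [x|e t t01].
    have [_ _ _ [dv _] _] := FP v; have [_ _ _ [dw _] _] := FP w.
    move=> h1 h2; move: (h1) (h2); rewrite dv dw.
    case: eqP => [xv|_] /=; last by move=> ?; exfalso; lra.
    case: eqP => [xw|_] /=; last by move=> ? ?; exfalso; lra.
    by move: h1; rewrite -xv -xw => h1 _ _; exact: phom_refl (pdel _ _ h1).
  by move=> h1 h2; apply: (phom_trans (L3 _ _ _ t01 h1)); exact: phom_sym (L3 _ _ _ t01 h2).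
(* The star chosen for each point is arbitrary; by [compat], the homotopy class of the resulting
   path does not depend on it. *)
have /choice[ch chP] : forall p : rz, exists v, d v p < 3 / 4.
  apply: realization_ind => [x|e t t01].
    by exists x; have [_ _ _ [-> _] _] := FP x; rewrite eqxx /=; lra.
  have [th|th] := ltP t (3 / 4).
    by exists (val e).1; have [_ _ /(_ e t t01 erefl)[-> _] _ _] := FP (val e).1.
  exists (val e).2; rewrite -edge_at_redge.
  have t01' : 0 <= 1 - t <= 1 by lra.
  have [_ _ /(_ (redge e) (1 - t) t01' erefl)[-> _] _ _] := FP (val e).2; lra.
exists (fun p => del (ch p) p); split.
- by move=> p; exact: pdel.
- by move=> p; rewrite /del pcat0.
- by move=> p; rewrite /del pcat1 pback1 tr0.
apply: locally_parallel => //.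
- by move=> p; exact: pdel.
- by move=> p; rewrite /del pcat1 pback1 tr0.
move=> p; exists [set p' | d (ch p) p' < 3 / 4].
  apply: open_nbhs_nbhs; split; last exact: chP.
  have [[cd _ _] _ _ _ _] := FP (ch p).
  by apply: (@open_lt_cont _ _ (d (ch p)) (fun=> 3 / 4)) => //; exact: cont_cst.
move=> q pq Uq; have cq : continuous q by case: pq.
pose H (z : R * R) := skel (F (ch p) (q z.1, z.2)).
have cH : continuous H.
  refine (cont_comp _ cs); refine (cont_comp _ (cF (ch p))).
  by apply: cont_pair; [refine (cont_comp _ cq)|]; cont.
have H1 : (fun s => H (s, 1)) = fun=> g (ch p) 1.
  by apply/funext => s; rewrite /H /= F1 ?g1 //; exact: Uq.
have H0 : (fun s => H (s, 0)) = fun s => skel (q s).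
  by apply/funext => s; rewrite /H /= F0.
rewrite /parallel -H0; apply: (@parallel_deform _ _ H (g (ch p)) (g (ch p))) => //.
- by rewrite H0; exact: ppath_comp cs pq.
- by rewrite H1; exact: ppath_cst.
- by rewrite /H /= F1 ?g1 //; exact: Uq.
- by rewrite H1; exact: phom_id.
- by apply: compat; [exact: chP|exact: Uq].
- by apply: compat; [exact: chP|exact: Uq].
Qed.

End SkeletonSection.

(** * Extension of the section over the cells *)

Section ComplexSection.
Context {R : realType} {X : graph} {k : nat} (x0 : X).
Local Notation rz := (realization R X).
Local Notation cx := (polygonal_complex R X k).
Local Notation vpt := (vertex_point R).
Local Notation skel := (@skel R X k).
Local Notation disc_at := (@disc_at R X k).
Local Notation boundary := (@boundary R X k).

(** The radial projection to the skeleton, discontinuous at the centres. *)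
Lemma radial_projection : exists ret : cx -> rz, exists rad : cx -> R,
  [/\ continuous rad /\ (forall p, rad (skel p) = 1),
      forall c z, rad (disc_at c z) = clamp z.2,
      forall p, ret (skel p) = p,
      forall c s rho, 0 <= s <= 1 -> 0 < rho -> ret (disc_at c (s, rho)) = boundary c s &
      forall q : R -> cx, continuous q -> (forall t, 0 < rad (q t)) ->
        continuous (fun t => ret (q t))].
Proof.
have [rad [cr rs rd]] := @radius_exists R X k.
(* At a centre the projection takes the default value [boundary c 0], which does not depend on the
   angle, as the gluing demands. *)
have [c rho _|c s t|c s s01|ret [retg rete]] := @complex_lift R X k _ (fun p : rz => p)
  (fun c s rho => boundary c (if 0 < rho then s else 0)).
- case: ifP => // _; rewrite /boundary mulr0 mulr1 walk_le0 //.
  by rewrite walk_ge ?cell_closed //; exact: cell_path.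
- by rewrite ltxx.
- by rewrite ltr01.
exists ret, rad; split=> //.
  move=> c s rho s01 r0; rewrite rete /= (clamp_id s01) ifT //.
  by case: (clampP rho) => -[h ->] //; lra.
move=> q cq rq; apply/continuousP => W oW.
(* Removing the centres makes the preimage of [W] open in every chart, although [ret] is not
   continuous. *)
rewrite (_ : _ @^-1` _ = q @^-1` [set p | 0 < rad p /\ W (ret p)]); last first.
  by apply/seteqP; split=> t /=; [split|case].
have /continuousP := cq; apply.
have [_ _ fin] := @cchart_final R X k; apply: fin => -[i|c].
  rewrite (_ : _ @^-1` _ = rchart i @^-1` W).
    by have [c1 _ _] := @rchart_final R X; have /continuousP := c1 i; apply.
  by apply/seteqP; split=> z /=; rewrite retg ?rs => // -[].
rewrite (_ : _ @^-1` _ = [set z | 0 < clamp z.2] `&`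
  (fun z => boundary c (clamp z.1)) @^-1` W); last first.
  by apply/seteqP; split=> z /=; rewrite rete rd => -[z0]; rewrite z0.
have cc := @clamp_cont R.
have c1 : continuous (fun z : R * R => clamp z.1) by refine (cont_comp _ cc); cont.
have c2 : continuous (fun z : R * R => clamp z.2) by refine (cont_comp _ cc); cont.
apply: openI; first by apply: (@open_lt_cont _ _ (fun=> 0)) => //; exact: cont_cst.
have cb := @boundary_cont R X k c.
have cf : continuous (fun z : R * R => boundary c (clamp z.1)) by refine (cont_comp _ cb).
by have /continuousP := cf; apply.
Qed.

(** A label naming the open cell of a point, [None] on the skeleton: it is well defined because
    discs are glued only along their boundaries, and it singles out one open disc as an open set
    without coordinates. *)
Lemma open_cells : exists cof : cx -> option (cell X k),
  (forall c s rho, 0 <= rho < 1 -> cof (disc_at c (s, rho)) = Some c) /\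
  forall (rad : cx -> R) c, (forall p, rad (skel p) = 1) ->
    (forall c z, rad (disc_at c z) = clamp z.2) ->
    open [set p | rad p < 2 / 3 /\ cof p = Some c].
Proof.
have [//|c s t|c s s01|cof [cg ce]] := @complex_lift R X k _ (fun p : rz => None)
  (fun c s rho => if rho < 1 then Some c else None).
- by [].
- by rewrite ltxx.
exists cof; split=> [c s rho /andP[r0 r1]|rad c rs rd].
  by rewrite ce /= clamp_id ?r1 // r0 ltW.
have [_ _ fin] := @cchart_final R X k; apply: fin => -[i|c'].
  rewrite (_ : _ @^-1` _ = set0); first exact: open0.
  by apply/seteqP; split=> z //=; rewrite rs => -[h]; exfalso; lra.
have cc := @clamp_cont R.
have c2 : continuous (fun z : R * R => clamp z.2) by refine (cont_comp _ cc); cont.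
have [cE|cN] := pselect (c' = c).
  rewrite (_ : _ @^-1` _ = [set z | clamp z.2 < 2 / 3]).
    by apply: (@open_lt_cont _ _ _ (fun=> 2 / 3)) => //; exact: cont_cst.
  apply/seteqP; split=> z /=; rewrite rd ce cE; first by case.
  by move=> h; split=> //; rewrite ifT //; lra.
rewrite (_ : _ @^-1` _ = set0); first exact: open0.
apply/seteqP; split=> z //=; rewrite rd ce => -[h].
by rewrite ifT; [case=> /cN|lra].
Qed.

Context (walks_equiv : forall p q, path (@adj X) x0 p -> path (@adj X) x0 q ->
  last x0 p = last x0 q -> walk_equiv k x0 p q).

(** Away from the centres a point is pushed to the boundary, where the skeleton section takes over.
    Within a cell it is pushed to the centre, which [gc c] reaches through the boundary point of
    angle 0. The two recipes agree on the annulus because the skeleton section is parallel along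
    boundary arcs. *)
Lemma complex_section : exists gamma : cx -> R -> cx,
  [/\ forall p, ppath (gamma p), forall p, gamma p 0 = skel (vpt x0),
      forall p, gamma p 1 = p &
      forall q, ppath q -> parallel id gamma q].
Proof.
have [g [pg g0 g1 gpar]] := @skeleton_section R X k x0 walks_equiv.
have [ret [rad [[cr rs] rd rets retd retc]]] := radial_projection.
have [cof [cofd cofo]] := open_cells.
have cs : continuous skel := @skel_cont R X k.
have cd := @disc_at_cont R X k.
(* [u] stretches the radius onto the boundary circle outside the centre, [w]
   shrinks it to the centre away from the boundary; the two domains overlap in
   the annulus [1/3 < rho < 2/3], where both sections follow a [ray]. *)
pose u (z : R * R) := (1 - z.2) * z.1 + z.2 * Num.min 1 (3 * z.1).
pose w (z : R * R) := (1 - z.2) * z.1 + z.2 * Num.max 0 (3 * z.1 - 2).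
have cu : continuous u by rewrite /u; cont.
have cw : continuous w by rewrite /w; cont.
have [F [cF Fs Fd]] : exists F : cx * R -> cx, [/\ continuous F,
    forall p t, F (skel p, t) = skel p &
    forall c s rho t, F (disc_at c (s, rho), t) = disc_at c (s, u (clamp rho, t))].
  apply: complex_deform => // t; rewrite /u /=.
    by rewrite !mulr0 (_ : Num.min _ _ = 0) ?mulr0 ?addr0 //; apply/min_idPr; lra.
  by rewrite (_ : Num.min _ _ = 1); [lra|apply/min_idPl; lra].
have [G [cG Gs Gd]] : exists F : cx * R -> cx, [/\ continuous F,
    forall p t, F (skel p, t) = skel p &
    forall c s rho t, F (disc_at c (s, rho), t) = disc_at c (s, w (clamp rho, t))].
  apply: complex_deform => // t; rewrite /w /=.
    by rewrite !mulr0 (_ : Num.max _ _ = 0) ?mulr0 ?addr0 //; apply/max_idPl; lra.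
  by rewrite (_ : Num.max _ _ = 1); [lra|rewrite (_ : 3 * 1 - 2 = 1 :> R);
    [apply/max_idPr; lra|lra]].
have F0 p : F (p, 0) = p.
  move: p; apply: complex_ind => [p|c s rho s01 r01]; first by rewrite Fs.
  by rewrite Fd clamp_id // /u /=; congr disc_at; congr pair; lra.
have G0 p : G (p, 0) = p.
  move: p; apply: complex_ind => [p|c s rho s01 r01]; first by rewrite Gs.
  by rewrite Gd clamp_id // /w /=; congr disc_at; congr pair; lra.
have F1 p : 1 / 3 < rad p -> F (p, 1) = skel (ret p).
  move: p; apply: complex_ind => [p|c s rho s01 r01]; first by rewrite Fs rets.
  rewrite rd Fd /= clamp_id // => r3; rewrite retd //; last lra.
  by apply: disc_at_boundary => //; rewrite /u /= (min_idPl _); lra.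
have G1 c s rho : 0 <= rho <= 1 -> rho < 2 / 3 -> G (disc_at c (s, rho), 1) = disc_at c (0, 0).
  move=> r01 r2; rewrite Gd clamp_id // (_ : w _ = 0); first exact: disc_at_centre.
  by rewrite /w /= (max_idPl _); lra.
pose trF p (t : R) := F (p, seg 0 1 t).
pose trG p (t : R) := G (p, seg 0 1 t).
have ptF p : ppath (trF p).
  apply: (@ppath_comp _ _ _ (fun s : R => F (p, s))); last exact: ppath_seg.
  by refine (cont_comp _ cF); cont.
have ptG p : ppath (trG p).
  apply: (@ppath_comp _ _ _ (fun s : R => G (p, s))); last exact: ppath_seg.
  by refine (cont_comp _ cG); cont.
have pd c (f : R -> R * R) : ppath f -> ppath (fun t => disc_at c (f t)).
  exact: ppath_comp (cd c).
have prad (s a b : R) : ppath (fun t => (s, seg a b t)).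
  by apply: (@ppath_comp _ _ _ (fun x : R => (s, x))); [cont|exact: ppath_seg].
have pang (s a b : R) : ppath (fun t => (seg a b t, s)).
  by apply: (@ppath_comp _ _ _ (fun x : R => (x, s))); [cont|exact: ppath_seg].
pose gc c := pcat (g (boundary c 0)) (fun t => disc_at c (0, seg 1 0 t)).
have gcE c : g (boundary c 0) 1 = disc_at c (0, seg 1 0 0).
  by rewrite g1 seg0 disc_at_boundary // lexx ler01.
have pgc c : ppath (gc c).
  by apply: ppath_cat => //; apply: pd.
have gc1 c : gc c 1 = disc_at c (0, 0) by rewrite /gc pcat1 seg1.
pose dA p := pcat (g (ret p)) (pback (trF p)).
pose dC c p := pcat (gc c) (pback (trG p)).
pose ray c s rho := pcat (g (boundary c s)) (fun t => disc_at c (s, seg 1 rho t)).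
have A1 c s rho : 0 <= s <= 1 -> 0 <= rho <= 1 -> 1 / 3 < rho ->
    phom (dA (disc_at c (s, rho))) (ray c s rho).
  move=> s01 r01 r3; rewrite /dA retd //; last lra.
  apply: phom_catr => //; first by rewrite g1 pback0 /trF seg1 F1 ?retd ?rd ?clamp_id //; lra.
  rewrite (_ : pback _ = fun t => disc_at c (s, pback (fun t => u (rho, seg 0 1 t)) t)); last first.
    by apply/funext => t; rewrite /pback /trF Fd clamp_id.
  apply: (@phom_comp _ _ _ (fun x : R => disc_at c (s, x))).
    by have cdc := cd c; refine (cont_comp _ cdc); cont.
  have cu' : continuous (fun t : R => u (rho, t)) by refine (cont_comp _ cu); cont.
  apply: phom_line.
  - by apply: ppath_back; exact: (ppath_comp cu' (ppath_seg _ _)).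
  - exact: ppath_seg.
  - by rewrite pback0 seg1 seg0 /u /= (min_idPl _); lra.
  - by rewrite pback1 seg0 seg1 /u /=; lra.
have A2 c s rho : 0 <= s <= 1 -> 0 <= rho <= 1 -> rho < 2 / 3 ->
    phom (dC c (disc_at c (s, rho))) (ray c s rho).
  move=> s01 r01 r3.
  have rest : phom (dC c (disc_at c (s, rho)))
      (pcat (gc c) (fun t => disc_at c (s, seg 0 rho t))).
    apply: phom_catr => //; first by rewrite gc1 pback0 /trG seg1 G1.
    rewrite (_ : pback _ = fun t => disc_at c (s, pback (fun t => w (rho, seg 0 1 t)) t)); last first.
      by apply/funext => t; rewrite /pback /trG Gd clamp_id.
    apply: (@phom_comp _ _ _ (fun x : R => disc_at c (s, x))).
      by have cdc := cd c; refine (cont_comp _ cdc); cont.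
    have cw' : continuous (fun t : R => w (rho, t)) by refine (cont_comp _ cw); cont.
    apply: phom_line.
    - by apply: ppath_back; exact: (ppath_comp cw' (ppath_seg _ _)).
    - exact: ppath_seg.
    - by rewrite pback0 seg1 seg0 /w /= (max_idPl _); lra.
    - by rewrite pback1 seg0 seg1 /w /=; lra.
  apply: (phom_trans rest).
  (* The arc from angle 0 to angle [s]: transport along it replaces the skeleton path ending at
     [boundary c 0] by the one ending at [boundary c s]. *)
  have pb : ppath (fun t => boundary c (seg 0 s t)).
    exact: (ppath_comp (@boundary_cont R X k c) (ppath_seg _ _)).
  have := gpar _ pb; rewrite /parallel seg0 seg1 => par.
  have bE : (fun t => skel (boundary c (seg 0 s t))) = fun t => disc_at c (seg 0 s t, 1).
    apply/funext => t; rewrite disc_at_boundary // /seg subr0 add0r.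
    by have := clamp_itv t; nra.
  rewrite bE in par.
  have e01 : g (boundary c 0) 1 = disc_at c (seg 0 s 0, 1).
    by rewrite seg0 g1 disc_at_boundary // lexx ler01.
  apply: (@phom_trans _ _ (pcat (pcat (g (boundary c 0)) (fun t => disc_at c (seg 0 s t, 1)))
      (fun t => disc_at c (s, seg 1 rho t)))); last first.
    by apply: phom_catl => //; [exact: pd|rewrite pcat1 seg0 seg1].
  (* In polar coordinates: down to the centre at angle 0, across to angle [s] at
     radius 0, and out, against along the boundary and then in. *)
  have H : phom (pcat (pcat (fun t => (0, seg 1 0 t)) (fun t => (seg 0 s t, 0)))
       (fun t => (s, seg 0 rho t)))
     (pcat (fun t => (seg 0 s t, 1 : R)) (fun t => (s, seg 1 rho t))).
    apply: phom_plane.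
    - apply: ppath_cat => //; first by rewrite pcat1 seg0 seg1.
      by apply: ppath_cat => //; rewrite seg0 seg1.
    - by apply: ppath_cat => //; rewrite seg0 seg1.
    - by rewrite !pcat0 !seg0.
    - by rewrite !pcat1 !seg1.
  have {H} := phom_comp (cd c) H; rewrite !pcat_comp => H.
  have Mc : (fun t => disc_at c (seg 0 s t, 0)) = fun=> disc_at c (0, seg 1 0 1).
    by apply/funext => t; rewrite seg1; exact: disc_at_centre.
  rewrite Mc in H.
  apply: (@phom_trans _ _ (pcat (g (boundary c 0)) (pcat (fun t => disc_at c (0, seg 1 0 t))
    (fun t => disc_at c (s, seg 0 rho t))))).
    apply: phom_catA => //; try exact: pd.
    by rewrite seg0 seg1; exact: disc_at_centre.
  apply: phom_sym.
  apply: (phom_trans (phom_catA _ _ _ _ _)) => //; try exact: pd.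
    by rewrite seg0 seg1.
  apply: phom_catr => //; first by rewrite pcat0.
  apply: (phom_trans (phom_sym H)); apply: phom_catl; first exact: pd.
    by rewrite pcat1 seg1 seg0; exact: disc_at_centre.
  by apply: (@phom_id _ _ (fun t => disc_at c (0, seg 1 0 t))); exact: pd.
have cellP p : rad p < 1 -> exists c s rho,
    [/\ p = disc_at c (s, rho), 0 <= s <= 1, 0 <= rho <= 1 & rad p = rho].
  move: p; apply: complex_ind => [p|c s rho s01 r01 _]; first by rewrite rs ltxx.
  by exists c, s, rho; rewrite rd clamp_id.
have compat p c : 1 / 3 < rad p -> rad p < 2 / 3 -> cof p = Some c ->
    phom (dA p) (dC c p).
  move=> p1 p2; have [|c' [s [rho [pE s01 r01 rE]]]] := cellP p; first by lra.
  rewrite rE in p1 p2; rewrite pE cofd; last by apply/andP; split; lra.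
  move=> [<-]; apply: (phom_trans (A1 _ _ _ s01 r01 p1)).
  exact: phom_sym (A2 _ _ _ s01 r01 p2).
have pdA p : 1 / 3 < rad p -> ppath (dA p).
  move=> rp; apply: ppath_cat => //; last exact: ppath_back.
  by rewrite g1 pback0 /trF seg1 F1.
have dA0 p : dA p 0 = skel (vpt x0) by rewrite /dA pcat0.
have dA1 p : dA p 1 = p by rewrite /dA pcat1 pback1 /trF seg0 F0.
have cofP p c : rad p < 2 / 3 -> cof p = Some c -> G (p, 1) = disc_at c (0, 0).
  move=> rp; have [|c' [s [rho [pE s01 r01 rE]]]] := cellP p; first by lra.
  rewrite rE in rp; rewrite pE cofd; last by apply/andP; split; lra.
  by move=> [<-]; exact: G1.
have pdC p c : rad p < 2 / 3 -> cof p = Some c -> ppath (dC c p).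
  move=> rp cp; apply: ppath_cat => //; last exact: ppath_back.
  by rewrite gc1 pback0 /trG seg1 (cofP p c).
have cof_ex p : rad p < 2 / 3 -> exists c, cof p = Some c.
  move=> rp; have [|c' [s [rho [pE s01 r01 rE]]]] := cellP p; first by lra.
  by rewrite rE in rp; exists c'; rewrite pE; apply: cofd; apply/andP; split; lra.
(* The last branch is a default that is never taken: by [cof_ex], a point of small radius has a
   cell. *)
pose Gam p := if 1 / 3 < rad p then dA p else if cof p is Some c then dC c p else dA p.
have GamP p : [/\ ppath (Gam p), Gam p 0 = skel (vpt x0) & Gam p 1 = p].
  rewrite /Gam; have [rp|rp] := ltP (1 / 3) (rad p).
    by split; [exact: pdA| |].
  have r2 : rad p < 2 / 3 by lra.
  have [c cp] := cof_ex p r2; rewrite cp; split; first exact: pdC.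
    by rewrite /dC pcat0 /gc pcat0.
  by rewrite /dC pcat1 pback1 /trG seg0 G0.
have GamA p : 1 / 3 < rad p -> Gam p = dA p by rewrite /Gam => ->.
have GamC p c : rad p < 2 / 3 -> cof p = Some c -> phom (Gam p) (dC c p).
  move=> rp cp; rewrite /Gam; have [rp'|rp'] := ltP (1 / 3) (rad p).
    exact: compat.
  by rewrite cp; apply: phom_refl; exact: pdC.
exists Gam; split; try by move=> p; have [] := GamP p.
apply: locally_parallel; first exact: cont_id.
- by move=> p; have [] := GamP p.
- by move=> p; have [] := GamP p.
move=> p; have [rp|rp] := ltP (1 / 3) (rad p).
  exists [set p | 1 / 3 < rad p].
    apply: open_nbhs_nbhs; split=> //.
    by apply: (@open_lt_cont _ _ (fun=> 1 / 3)) => //; exact: cont_cst.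
  move=> q pq Uq; have cq : continuous q by case: pq.
  (* The radial projection is continuous along [q] because [q] avoids the centres. *)
  have prq : ppath (fun t => ret (q t)).
    split; first by apply: retc => // t; have /= := Uq t; lra.
    - by case: pq => _ q0 _ t /q0 ->.
    - by case: pq => _ _ q1 t /q1 ->.
  pose H (z : R * R) := F (q z.1, z.2).
  have cH : continuous H.
    refine (cont_comp _ cF); apply: cont_pair; [refine (cont_comp _ cq)|]; cont.
  have H0 : (fun s => H (s, 0)) = q by apply/funext => s; rewrite /H F0.
  have H1 : (fun s => H (s, 1)) = fun s => skel (ret (q s)).
    by apply/funext => s; rewrite /H F1 //; exact: Uq.
  rewrite /parallel -[X in pcat _ X]/q -[X in pcat _ X]H0.
  apply: (@parallel_deform _ _ H (g (ret (q 0))) (g (ret (q 1)))) => //.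
  - by rewrite H0.
  - by rewrite H1; exact: ppath_comp cs prq.
  - by rewrite g1 /H F1 //; exact: Uq.
  - by rewrite H1; exact: gpar.
  - by rewrite GamA; [exact: phom_refl (pdA _ (Uq _))|exact: Uq].
  - by rewrite GamA; [exact: phom_refl (pdA _ (Uq _))|exact: Uq].
have r2 : rad p < 2 / 3 by lra.
have [c cp] := cof_ex p r2.
exists [set p | rad p < 2 / 3 /\ cof p = Some c].
  by apply: open_nbhs_nbhs; split=> //; exact: cofo.
move=> q pq Uq; have cq : continuous q by case: pq.
pose H (z : R * R) := G (q z.1, z.2).
have cH : continuous H.
  refine (cont_comp _ cG); apply: cont_pair; [refine (cont_comp _ cq)|]; cont.
have H0 : (fun s => H (s, 0)) = q by apply/funext => s; rewrite /H G0.
have H1 : (fun s => H (s, 1)) = fun=> gc c 1.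
  by apply/funext => s; rewrite /H gc1; apply: cofP; apply Uq.
rewrite /parallel -[X in pcat _ X]/q -[X in pcat _ X]H0.
apply: (@parallel_deform _ _ H (gc c) (gc c)) => //.
- by rewrite H0.
- by rewrite H1; exact: ppath_cst.
- by have /= := congr1 (fun f => f 0) H1 => <-.
- by rewrite H1; exact: phom_id.
- by apply: GamC; apply Uq.
- by apply: GamC; apply Uq.
Qed.

Lemma complex_simply_connected : simply_connected R cx.
Proof.
have [g [pg g0 g1 gpar]] := complex_section.
have cv := @unit_val_cont R.
split.
- by exists (skel (vpt x0)).
- move=> x y; pose f := pcat (pback (g x)) (g y).
  have pf : ppath f.
    by apply: ppath_cat => //; [rewrite pback1 !g0|exact: ppath_back].
  have cf : continuous (fun u : unit_interval R => f (unit_val u)).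
    have cf' : continuous f by case: pf.
    by refine (cont_comp _ cf').
  have f0 : f (unit_val zero) = x.
    by rewrite [unit_val zero]/(0 : R) /f pcat0 pback0 g1.
  have f1 : f (unit_val one) = y.
    by rewrite [unit_val one]/(1 : R) /f pcat1 g1.
  by exists (mk_path cf f0 f1).
move=> x q; have q0 : q zero = x := path_zero; have q1 : q one = x := path_one.
have cq : continuous q by move=> u; exact: cts_fun.
pose f (t : R) := q (clampI t).
have pf : ppath f.
  split; first by have cI := @clampI_cont R; refine (cont_comp _ cq).
  - by move=> t t0; rewrite /f !clampI0.
  - by move=> t t1; rewrite /f !clampI1.
have f0 : f 0 = x by rewrite /f clampI0.
have f1 : f 1 = x by rewrite /f clampI1.
have := gpar _ pf; rewrite /parallel f0 f1 => par.
have [H [cH H0 H1 He]] : phom f (fun=> f 0).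
  by apply: (phom_cancell (pg x) pf) => //; rewrite g1 f0.
(* The homotopy parameter is the first coordinate in [phom] and the second in [null_homotopic]. *)
exists (fun z => H (unit_val z.2, unit_val z.1)); split=> /=.
- refine (cont_comp _ cH); apply: cont_pair; refine (cont_comp _ cv); cont.
- by move=> s; rewrite [unit_val zero]/(0 : R) H0 /f clampI_val.
- by move=> s; rewrite [unit_val one]/(1 : R) H1.
- move=> t; rewrite [unit_val zero]/(0 : R) [unit_val one]/(1 : R).
  have [h0 _] := He (unit_val t) 0; have [_ h1] := He (unit_val t) 1.
  by rewrite h0 // h1 // f0 f1.
Qed.

End ComplexSection.

(** * Coverings and the covering graph *)

(** A section [g] of [f] over [A] is an injection of the finite set [A] into itself, hence onto.
    Every point of [A] is thus some [g y], and [f] recovers [y]. The map [f] may send points of [A]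
    outside [A]. *)
Lemma finite_surj_inj {T : choiceType} (A : set T) (f : T -> T) :
  finite_set A -> A `<=` f @` A ->
  forall a b, A a -> A b -> f a = f b -> a = b.
Proof.
move=> /finite_seqP[s0 AE] fA.
have : exists s, uniq s /\ A = [set` s].
  exists (undup s0); rewrite undup_uniq AE; split=> //.
  by apply/seteqP; split=> x /=; rewrite mem_undup.
move=> [s [us As]].
have /choice[g gP] : forall y, exists x, A y -> A x /\ f x = y.
  move=> y; have [Ay|nAy] := pselect (A y); last by exists y.
  by have [x Ax fx] := fA y Ay; exists x.
have sA x : x \in s <-> A x by rewrite As.
have ug : uniq (map g s).
  rewrite map_inj_in_uniq // => x y /sA/gP[_ gx] /sA/gP[_ gy] gxy.
  by rewrite -gx -gy gxy.
have sg : {subset map g s <= s}.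
  by move=> _ /mapP[x /sA/gP[Ag _] ->]; exact/sA.
have [] := uniq_min_size ug sg; first by rewrite size_map.
move=> _ E a b /sA; rewrite -E => /mapP[y /sA/gP[_ gy] ->] /sA.
by rewrite -E => /mapP[z /sA/gP[_ gz] ->]; rewrite gy gz => ->.
Qed.

Section Distance.
Context {X : graph}.

Definition within_dist (m : nat) (x y : X) :=
  exists p, [/\ path (@adj X) x p, last x p = y & (size p <= m)%N].

Lemma within_refl m x : within_dist m x x.
Proof. by exists [::]. Qed.

Lemma within_trans a b x y z :
  within_dist a x y -> within_dist b y z -> within_dist (a + b) x z.
Proof.
move=> [p [xp lp sp]] [q [yq lq sq]]; exists (p ++ q).
by rewrite cat_path xp lp last_cat lp size_cat leq_add.
Qed.

Lemma within_leq a b x y : (a <= b)%N -> within_dist a x y -> within_dist b x y.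
Proof. by move=> ab [p [xp lp sp]]; exists p; split=> //; exact: leq_trans ab. Qed.

Lemma within_adj x y : adj x y -> within_dist 1 x y.
Proof. by move=> xy; exists [:: y]; rewrite /= xy. Qed.

Lemma path_back (x : X) p : path (@adj X) x p ->
  exists q, [/\ path (@adj X) (last x p) q, last (last x p) q = x & size q = size p].
Proof.
move=> xp; exists (rev (belast x p)); split.
- by rewrite rev_path (eq_path (e' := @adj X)) // => y z; rewrite adj_sym.
- by case: p {xp} => //= y p; rewrite rev_cons last_rcons.
- by rewrite size_rev size_belast.
Qed.

Lemma within_finite m x : finite_set [set y | within_dist m x y].
Proof.
elim: m x => [|m IH] x.
  apply: sub_finite_set (finite_set1 x) => y [p [_ <- /=]].
  by rewrite leqn0 => /eqP/size0nil ->.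
pose U := [set x] `|` \bigcup_(z in neighbors x) [set y | within_dist m z y].
apply: (@sub_finite_set _ _ U).
  move=> y [[|z p] [/= xp lp sp]]; first by left.
  move/andP: xp => [xz zp]; right; exists z => //; exists p; split=> //.
rewrite finite_setU; split; first exact: finite_set1.
apply: bigcup_finite; first exact: graph_locally_finite.
by move=> z _; exact: IH.
Qed.

End Distance.

Section Coverings.
Context {X Y : graph} (f : X -> Y).

Lemma covering_map_path x p : graph_covering f -> path (@adj X) x p ->
  path (@adj Y) (f x) (map f p).
Proof. by move=> [_ hf _]; apply: homo_path. Qed.

Lemma covering_lift x q : graph_covering f -> path (@adj Y) (f x) q ->
  exists2 p, path (@adj X) x p & map f p = q.
Proof.
move=> cf; have [_ _ nf] := cf.
elim: q x => [|z q IH] x /=; first by exists [::].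
move=> /andP[xz zq]; have [_ _ sf] := nf x.
have [x' xx' fx'] := sf z xz; rewrite -fx' in zq.
by have [p x'p <-] := IH _ zq; exists (x' :: p); rewrite /= ?fx' // x'p andbT.
Qed.

Lemma covering_within m x y : graph_covering f -> within_dist m x y ->
  within_dist m (f x) (f y).
Proof.
move=> cf [p [xp <- sp]]; exists (map f p).
by rewrite covering_map_path // last_map size_map.
Qed.

Lemma covering_within_lift m x z : graph_covering f -> within_dist m (f x) z ->
  exists2 y, within_dist m x y & f y = z.
Proof.
move=> cf [q [xq <- sq]]; have [p xp pq] := covering_lift cf xq.
exists (last x p); last by rewrite -pq last_map.
by exists p; split=> //; rewrite -(size_map f) pq.
Qed.

End Coverings.

Lemma covering_comp {X Y Z : graph} (f : X -> Y) (g : Y -> Z) :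
  graph_covering f -> graph_covering g -> graph_covering (g \o f).
Proof.
move=> [sf hf nf] [sg hg ng]; split.
- move=> z _; have [y _ <-] := sg z I; have [x _ <-] := sf y I.
  by exists x.
- by move=> x y /hf/hg.
- by move=> x; exact: set_bij_comp (nf x) (ng (f x)).
Qed.

(** A covering maps balls onto balls, and balls of the same radius have the
    same finite cardinality. *)
Lemma self_covering_inj (X : graph) (h : X -> X) :
  vertex_transitive X -> graph_covering h -> injective h.
Proof.
move=> vt ch a b hab.
(* The automorphism [al] moves [h a] back to [a], so that [al \o h] covers the ball around [a] by
   itself; the radius, the length of a path from [a] to [b], puts [b] in that ball. *)
have [al [bal mal ala]] := vt (h a) a.
have [p ap lp] := graph_connected a b.
apply: (@finite_surj_inj _ [set y | within_dist (size p) a y] (al \o h)) => /=.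
- exact: within_finite.
- move=> y /= [q [aq lq sq]]; have [be alK beK] := bal.
  have mbe : {homo be : u v / adj u v} by move=> u v uv; rewrite -mal !beK.
  have : within_dist (size p) (h a) (be y).
    exists (map be q); rewrite size_map sq; have hE : h a = be a by rewrite -[in RHS]ala alK.
    by rewrite hE last_map lq; split=> //; exact: (homo_path mbe aq).
  by move=> /(covering_within_lift ch)[z az hz]; exists z => //=; rewrite hz beK.
- exact: within_refl.
- by exists p.
- by rewrite hab.
Qed.

(** * The covering graph of classes of walks *)

Section Cover.
Context {X : graph} (k : nat) (hk : (2 <= k)%N) (x0 : X).

(** With canonical representatives instead of a quotient, the vertices of the cover form a subtype
    of [seq X], which is already a [choiceType]. *)
Definition walk_repr (p : seq X) : seq X := choose (fun q => `[< walk_equiv k x0 p q >]) p.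

Lemma walk_repr_equiv p : walk_equiv k x0 p (walk_repr p).
Proof.
have P0 : `[< walk_equiv k x0 p p >] by apply/asboolP; exact: rst_refl.
exact/asboolP/(@chooseP _ (fun q => `[< walk_equiv k x0 p q >]) p P0).
Qed.

Lemma walk_reprP p q : walk_equiv k x0 p q <-> walk_repr p = walk_repr q.
Proof.
split=> [pq|E]; last first.
  apply: rst_trans (walk_repr_equiv p) _; rewrite E.
  exact: rst_sym (walk_repr_equiv q).
rewrite /walk_repr; have E : (fun r => `[< walk_equiv k x0 p r >]) =1
    (fun r => `[< walk_equiv k x0 q r >]).
  move=> r; apply/asboolP/asboolP; apply: rst_trans => //; exact: rst_sym.
rewrite (eq_choose E); apply: choose_id; apply/asboolP; last exact: rst_refl.
exact: rst_sym.
Qed.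

Lemma walk_reprK p : walk_repr (walk_repr p) = walk_repr p.
Proof. by apply/walk_reprP/rst_sym/walk_repr_equiv. Qed.

Lemma walk_repr_path p : path (@adj X) x0 (walk_repr p) = path (@adj X) x0 p.
Proof. by have [->] := walk_equiv_walk (walk_repr_equiv p). Qed.

Lemma walk_repr_last p : last x0 (walk_repr p) = last x0 p.
Proof. by have [_ ->] := walk_equiv_walk (walk_repr_equiv p). Qed.

Definition cover_vertex :=
  {p : seq X | path (@adj X) x0 p && (walk_repr p == p)}.

Lemma cover_root_subproof :
  path (@adj X) x0 (walk_repr [::]) && (walk_repr (walk_repr [::]) == walk_repr [::]).
Proof. by rewrite walk_repr_path walk_reprK eqxx. Qed.

Definition cover_root : cover_vertex :=
  exist (fun p : seq X => is_true (path (@adj X) x0 p && (walk_repr p == p)))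
    _ cover_root_subproof.

Definition walk_class (p : seq X) : cover_vertex := insubd cover_root (walk_repr p).

Lemma val_walk_class p : path (@adj X) x0 p -> val (walk_class p) = walk_repr p.
Proof.
move=> xp; rewrite /walk_class val_insubd ifT //.
by rewrite walk_repr_path xp walk_reprK eqxx.
Qed.

Lemma walk_class_val (u : cover_vertex) : walk_class (val u) = u.
Proof. by have /andP[_ /eqP E] := valP u; rewrite /walk_class E valKd. Qed.

Lemma val_path (u : cover_vertex) : path (@adj X) x0 (val u).
Proof. by have /andP[] := valP u. Qed.

Lemma walk_class_eq p q : walk_equiv k x0 p q -> walk_class p = walk_class q.
Proof. by move=> /walk_reprP pq; rewrite /walk_class pq. Qed.

Lemma walk_class_equiv p : path (@adj X) x0 p -> walk_equiv k x0 p (val (walk_class p)).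
Proof. by move=> xp; rewrite val_walk_class //; exact: walk_repr_equiv. Qed.

Definition cover_proj (u : cover_vertex) : X := last x0 (val u).

Lemma cover_proj_class p : path (@adj X) x0 p -> cover_proj (walk_class p) = last x0 p.
Proof. by move=> xp; rewrite /cover_proj val_walk_class // walk_repr_last. Qed.

Definition cover_adj : rel cover_vertex := fun u v =>
  adj (cover_proj u) (cover_proj v) &&
  (v == walk_class (rcons (val u) (cover_proj v))).

Lemma cover_adj_class p z : path (@adj X) x0 (rcons p z) ->
  cover_adj (walk_class p) (walk_class (rcons p z)).
Proof.
move=> xpz; have := xpz; rewrite rcons_path => /andP[xp pz].
rewrite /cover_adj !cover_proj_class // last_rcons pz /=; apply/eqP.
apply: walk_class_eq; rewrite -!cats1; apply: walk_equiv_catr.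
exact: walk_class_equiv.
Qed.

Lemma cover_adjP u v : cover_adj u v ->
  path (@adj X) x0 (rcons (val u) (cover_proj v)) /\
  v = walk_class (rcons (val u) (cover_proj v)).
Proof. by move=> /andP[uv /eqP vE]; rewrite rcons_path val_path. Qed.

(** A step followed by its reverse is a closed walk of length 2, hence can be erased since
    [2 <= k]. *)
Lemma cover_adj_sym : symmetric cover_adj.
Proof.
suff H u v : cover_adj u v -> cover_adj v u.
  by move=> u v; apply/idP/idP; exact: H.
move=> uv; have [xu vE] := cover_adjP uv; move/andP: uv => [uv _].
rewrite /cover_adj adj_sym uv /=; apply/eqP.
have xuu : path (@adj X) x0 (rcons (rcons (val u) (cover_proj v)) (cover_proj u)).
  by rewrite rcons_path xu last_rcons adj_sym.
rewrite -[LHS]walk_class_val; apply: walk_class_eq.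
apply: (@rst_trans _ _ _ (rcons (rcons (val u) (cover_proj v)) (cover_proj u))).
  apply: rst_step; exists (val u), [:: cover_proj v; cover_proj u], [::].
  rewrite cats0 /= -!cats1 -catA; split=> //.
  by rewrite -/(cover_proj u) uv adj_sym uv.
rewrite -(cats1 _ (cover_proj u)) -(cats1 _ (cover_proj u)).
apply: walk_equiv_catr; rewrite [in X in walk_equiv _ _ _ X]vE.
exact: walk_class_equiv.
Qed.

Lemma cover_adj_irrefl : irreflexive cover_adj.
Proof. by move=> u; rewrite /cover_adj adj_irrefl. Qed.

Lemma cover_connected u v : exists2 p, path cover_adj u p & last u p = v.
Proof.
have from_root q : path (@adj X) x0 q ->
    exists2 p, path cover_adj (walk_class [::]) p & last (walk_class [::]) p = walk_class q.
  elim/last_ind: q => [|q z IH]; first by exists [::].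
  move=> xqz; have := xqz; rewrite rcons_path => /andP[xq qz].
  have [p rp lp] := IH xq; exists (rcons p (walk_class (rcons q z))).
    by rewrite rcons_path rp lp; exact: cover_adj_class.
  by rewrite last_rcons.
have [p rp lp] := from_root _ (val_path u); rewrite walk_class_val in lp.
have [q rq lq] := from_root _ (val_path v); rewrite walk_class_val in lq.
exists (rev (belast (walk_class [::]) p) ++ q).
  rewrite cat_path -lp rev_path (eq_path (e' := cover_adj)); last first.
    by move=> a b; rewrite cover_adj_sym.
  rewrite rp /=; case: (p) => //= a s.
  by rewrite rev_cons last_rcons.
rewrite last_cat -lp; case: (p) => //= a s.
by rewrite rev_cons last_rcons.
Qed.

Lemma cover_locally_finite u : finite_set [set v | cover_adj u v].
Proof.
apply: (@sub_finite_set _ _ ((fun z => walk_class (rcons (val u) z)) @` neighbors (cover_proj u))).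
  move=> v /= uv; have [_ vE] := cover_adjP uv; exists (cover_proj v) => //.
  by case/andP: uv.
exact/finite_image/graph_locally_finite.
Qed.

Definition cover_graph : graph :=
  Graph cover_adj_sym cover_adj_irrefl (ex_intro _ cover_root I)
    cover_connected cover_locally_finite.

Lemma cover_proj_covering : @graph_covering cover_graph X cover_proj.
Proof.
split.
- move=> x _; have [p xp lp] := graph_connected x0 x.
  by exists (walk_class p) => //; rewrite cover_proj_class.
- by move=> u v /andP[].
move=> u; split.
- by move=> v /andP[].
- move=> v w /set_mem /cover_adjP[_ vE] /set_mem /cover_adjP[_ wE] vw.
  by rewrite vE wE vw.
- move=> z uz; exists (walk_class (rcons (val u) z)).
    have xuz : path (@adj X) x0 (rcons (val u) z) by rewrite rcons_path val_path.
    by have := cover_adj_class xuz; rewrite walk_class_val.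
  by rewrite cover_proj_class ?last_rcons // rcons_path val_path.
Qed.

Lemma cover_path_class (u : cover_graph) q : path (@adj cover_graph) u q ->
  walk_equiv k x0 (val u ++ map cover_proj q) (val (last u q)) /\
  path (@adj X) (cover_proj u) (map cover_proj q).
Proof.
elim: q u => [|v q IH] u /=; first by rewrite cats0; split=> //; exact: rst_refl.
move=> /andP[uv vq]; have [E xq] := IH v vq.
have [xu vE] := cover_adjP uv; split; last by rewrite xq andbT; case/andP: uv.
apply: rst_trans E; rewrite -cat_rcons; apply: walk_equiv_catr.
by rewrite [in X in walk_equiv _ _ _ X]vE; exact: walk_class_equiv.
Qed.

Lemma cover_proj_inj_ball n (y u v : cover_graph) : (2 * n <= k)%N ->
  within_dist n y u -> within_dist n y v -> cover_proj u = cover_proj v -> u = v.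
Proof.
move=> nk [p [yp lp sp]] [q [yq lq sq]] uv.
have [Ep xp] := cover_path_class yp; have [Eq xq] := cover_path_class yq.
rewrite lp in Ep; rewrite lq in Eq.
set p' := map cover_proj p in Ep xp; set q' := map cover_proj q in Eq xq.
have lp' : last (cover_proj y) p' = cover_proj u by rewrite last_map lp.
have lq' : last (cover_proj y) q' = cover_proj v by rewrite last_map lq.
have [r [zr lr sr]] := path_back xq.
have sp' : (size p' <= n)%N by rewrite size_map.
have sq' : (size q' <= n)%N by rewrite size_map.
rewrite lq' -uv in zr lr.
rewrite -[u]walk_class_val -[v]walk_class_val; apply: walk_class_eq.
apply: rst_trans (rst_sym _ _ _ _ Ep) _; apply: rst_trans Eq.
(* With [r] the reverse of [q'], this walk arises from [val y ++ p'] by inserting [r ++ q'] at its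
   end, and from [val y ++ q'] by inserting [p' ++ r] in the middle; both inserted walks are closed,
   of length at most [2 * n]. *)
apply: (@rst_trans _ _ _ (val y ++ (p' ++ r) ++ q')).
  apply: rst_step; exists (val y ++ p'), (r ++ q'), [::].
  rewrite cats0 -!catA; split=> //; rewrite ?last_cat -/(cover_proj y) ?lp'.
  - by rewrite cats0.
  - by rewrite cat_path zr lr.
  - by rewrite lr lq'.
  - by rewrite size_cat sr; apply: leq_trans nk; rewrite mul2n -addnn leq_add.
apply: rst_sym; apply: rst_step; exists (val y), (p' ++ r), q'.
split=> //; rewrite -/(cover_proj y).
- by rewrite cat_path xp lp'.
- by rewrite last_cat lp' lr.
- by rewrite size_cat sr; apply: leq_trans nk; rewrite mul2n -addnn leq_add.
Qed.

Lemma walks_equiv_of_cover : vertex_transitive X -> Defs.covered_by cover_graph X ->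
  forall p q, path (@adj X) x0 p -> path (@adj X) x0 q ->
  last x0 p = last x0 q -> walk_equiv k x0 p q.
Proof.
move=> vt [g cg] p q xp xq pq.
have hinj := self_covering_inj vt (covering_comp cg cover_proj_covering).
have [sg _ _] := cg.
have [a _ ga] := sg (walk_class p) I; have [b _ gb] := sg (walk_class q) I.
have ab : a = b by apply: hinj; rewrite /= ga gb !cover_proj_class.
by apply/walk_reprP; rewrite -!val_walk_class // -ga -gb ab.
Qed.

End Cover.

(** * Balls and their intrinsic metric *)

Section GraphDistance.
Context {X : graph}.
Implicit Types x z : X.

Lemma within_dist_ex x z : exists m, `[< within_dist m x z >].
Proof.
have [p xp lp] := graph_connected x z; exists (size p).
by apply/asboolP; exists p.
Qed.

Definition gdist x z : nat := ex_minn (within_dist_ex x z).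

Lemma gdistP m x z : within_dist m x z <-> (gdist x z <= m)%N.
Proof.
rewrite /gdist; case: ex_minnP => d /asboolP dP dmin; split.
  by move=> /asboolP /dmin.
by move=> dm; exact: within_leq dm dP.
Qed.

Lemma gdist_within x z : within_dist (gdist x z) x z.
Proof. exact/gdistP. Qed.

Lemma gdistxx x : gdist x x = 0%N.
Proof. by apply/eqP; rewrite -leqn0; apply/gdistP; exact: within_refl. Qed.

Lemma gdist_adj x z w : adj z w -> (gdist x w <= (gdist x z).+1)%N.
Proof.
move=> zw; apply/gdistP; rewrite -addn1.
exact: within_trans (gdist_within x z) (within_adj zw).
Qed.

End GraphDistance.

Section RealizationEquality.
Context {R : realType} {X : graph}.
Local Notation rz := (realization R X).
Local Notation vpt := (vertex_point R).
Local Notation ept := (@edge_at R X).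

Lemma edge_ept (e : edge X) u : edge_point e u = ept e (unit_val u).
Proof. by rewrite /edge_at clampI_val. Qed.

Lemma realization_cases (p : rz) : (exists z, p = vpt z) \/
  (exists e t, 0 < t < 1 /\ p = ept e t).
Proof.
move: p; apply: realization_ind => [z|e t /andP[t0 t1]]; first by left; exists z.
have [t00|t00] := leP t 0; first by left; exists (val e).1; rewrite edge_at_le0.
have [t11|t11] := leP 1 t; first by left; exists (val e).2; rewrite edge_at_ge1.
by right; exists e, t; rewrite t00 t11.
Qed.

(** Equality in the glued space is a generated equivalence, hard to refute directly; these
    coordinates descend to it and separate its points. *)
Lemma barycentric : exists bar : rz -> X -> R,
  (forall z w, bar (vpt z) w = (w == z)%:R) /\
  (forall e t w, 0 <= t <= 1 -> bar (ept e t) w =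
     (1 - t) * (w == (val e).1)%:R + t * (w == (val e).2)%:R).
Proof.
have [e|e t t01|bar [barv bare]] := @realization_lift R X _
  (fun z w => (w == z)%:R : R)
  (fun e t w => (1 - t) * (w == (val e).1)%:R + t * (w == (val e).2)%:R).
- by apply/funext => w; rewrite subr0 mul1r mul0r addr0.
- by apply/funext => w; rewrite /= subKr addrC.
exists bar; split=> [z w|e t w t01]; first by rewrite barv.
by rewrite bare clamp_id.
Qed.

Lemma vertex_point_inj : injective (@vertex_point R X).
Proof.
have [bar [barv _]] := barycentric => z w zw.
have := barv z z; rewrite zw barv eqxx.
by case: eqP => // _ /esym/eqP; rewrite oner_eq0.
Qed.

Lemma vertex_point_edge_at z e t : 0 <= t <= 1 -> vpt z = ept e t ->
  (t = 0 /\ z = (val e).1) \/ (t = 1 /\ z = (val e).2).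
Proof.
have [bar [barv bare]] := barycentric => t01 E.
have := barv z z; rewrite E bare // eqxx; have := edge_neq e.
case: (eqVneq z (val e).1) => [->|_].
  by move=> /negPf -> /= h; left; split=> //; lra.
case: (eqVneq z (val e).2) => [->|_] _ /= h; last by exfalso; lra.
by right; split=> //; lra.
Qed.

Lemma edge_at_inj e e' t t' : 0 < t < 1 -> 0 <= t' <= 1 -> ept e t = ept e' t' ->
  (e = e' /\ t = t') \/ (e = redge e' /\ t = 1 - t').
Proof.
have [bar [barv bare]] := barycentric => t01 t01' E.
have t01w : 0 <= t <= 1 by lra.
have ne := edge_neq e; have ne' := edge_neq e'.
have E1 : bar (ept e t) (val e).1 = bar (ept e' t') (val e).1 by rewrite E.
have E2 : bar (ept e t) (val e).2 = bar (ept e' t') (val e).2 by rewrite E.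
rewrite !bare // !eqxx in E1 E2; rewrite (negPf ne) in E1.
rewrite [(val e).2 == (val e).1]eq_sym (negPf ne) in E2.
move: E1 E2; case: (eqVneq (val e).1 (val e').1) => [e11|_].
  rewrite e11 (negPf ne') => /= E1.
  case: (eqVneq (val e).2 (val e').2) => [e22|_]; last first.
    rewrite -e11 eq_sym (negPf ne) /= => E2; exfalso; lra.
  rewrite -e11 eq_sym (negPf ne) /= => E2; left; split; last lra.
  by apply: val_inj; rewrite (surjective_pairing (val e)) e11 e22 -surjective_pairing.
case: (eqVneq (val e).1 (val e').2) => [e12|_] /= E1; last by move=> _; exfalso; lra.
rewrite -e12 [(val e).2 == (val e).1]eq_sym (negPf ne).
case: (eqVneq (val e).2 (val e').1) => [e21|_] /= E2; last by exfalso; lra.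
right; split; last lra.
by apply: val_inj; rewrite (surjective_pairing (val e)) e12 e21.
Qed.

End RealizationEquality.

Section Balls.
Context {R : realType} {X : graph} (x : X).
Local Notation rz := (realization R X).
Local Notation vpt := (vertex_point R).
Local Notation ept := (@edge_at R X).

(** [D] plays the role of the distance to [x]. Its last clause, a Lipschitz bound along piecewise
    linear paths, bounds lengths from below, as explicit walks bound distances from above. *)
Lemma realization_dist : exists D : rz -> R,
  [/\ forall z, D (vpt z) = (gdist x z)%:R,
      forall e t, 0 <= t <= 1 -> D (ept e t) =
        Num.min ((gdist x (val e).1)%:R + t) ((gdist x (val e).2)%:R + (1 - t)) &
      forall B p q l, pl_path B p q l -> D q <= D p + l].
Proof.
have [e|e t t01|D [Dv De]] := @realization_lift R X _
  (fun z => (gdist x z)%:R : R)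
  (fun e t => Num.min ((gdist x (val e).1)%:R + t) ((gdist x (val e).2)%:R + (1 - t))).
- rewrite addr0 subr0; apply/min_idPl; rewrite natr1 ler_nat.
  by apply: gdist_adj; rewrite adj_sym; exact: (valP e).
- by rewrite /= subKr minC.
have DE e t : 0 <= t <= 1 -> D (ept e t) =
    Num.min ((gdist x (val e).1)%:R + t) ((gdist x (val e).2)%:R + (1 - t)).
  by move=> t01; rewrite De clamp_id.
exists D; split=> // B p q l; elim=> [{}p _|e s t {}q {}l _ _ IH]; first by rewrite addr0.
apply: (le_trans IH); rewrite addrA lerD2r !edge_ept !DE ?unit_val_itv //.
have := ler_norm (unit_val s - unit_val t); have := ler_norm (unit_val t - unit_val s).
rewrite distrC => h1 h2; rewrite addr_minl le_min !ge_min.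
by apply/andP; split; apply/orP; [left|right]; lra.
Qed.

Lemma pl_edge B (e : edge X) (s t : R) q l : 0 <= s <= 1 -> 0 <= t <= 1 ->
  (forall w, Num.min s t <= w <= Num.max s t -> B (ept e w)) ->
  pl_path B (ept e t) q l -> pl_path B (ept e s) q (`|s - t| + l).
Proof.
move=> s01 t01 Bw pq.
have := @pl_cons R X B e (clampI s) (clampI t) q l.
rewrite !unit_val_clampI !clamp_id //; apply=> // w ws.
by rewrite edge_ept; exact: Bw.
Qed.

Lemma pl_walk (z : X) p (q : rz) l : path (@adj X) z p ->
  pl_path setT (vpt (last z p)) q l -> pl_path setT (vpt z) q ((size p)%:R + l).
Proof.
elim: p z => [|w p IH] z /=; first by rewrite add0r.
move=> /andP[zw wp] /(IH _ wp) H.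
have [e ee _] := run_adj (R := R) zw.
have -> : vpt z = ept e 0 by rewrite edge_at_le0 // ee.
rewrite (_ : (size p).+1%:R + l = `|0 - 1| + ((size p)%:R + l)); last first.
  by rewrite sub0r normrN normr1 addrA nat1r.
apply: pl_edge; rewrite ?lexx ?ler01 //.
by rewrite edge_at_ge1 // ee.
Qed.

Lemma intrinsic_dist_le B (p q : rz) l :
  pl_path B p q l -> (intrinsic_dist B p q <= l%:E)%E.
Proof. by move=> pl; apply: ereal_inf_lbound; exists l. Qed.

Lemma ball_vertex n z : graph_ball x (n%:R : R) (vpt z) <-> (gdist x z <= n)%N.
Proof.
have [D [Dv De DL]] := realization_dist.
split=> [H|zn].
  rewrite -(ler_nat R) -lee_fin; apply: le_trans H.
  apply: le_ereal_inf_tmp => _ [l /DL h <-]; rewrite lee_fin.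
  by move: h; rewrite !Dv gdistxx add0r.
have [p [xp lp sp]] := gdist_within x z.
apply: le_trans (_ : _ <= (size p)%:R%:E)%E _; last first.
  by rewrite lee_fin ler_nat; exact: leq_trans sp zn.
apply: intrinsic_dist_le; rewrite -[(size p)%:R]addr0; apply: pl_walk => //.
by rewrite lp; exact: pl_nil.
Qed.

Lemma ball_edge_half n e t : 0 <= t <= 1 -> (gdist x (val e).1 < n)%N ->
  graph_ball x (n%:R : R) (ept e t).
Proof.
move=> t01 en; have [p [xp lp sp]] := gdist_within x (val e).1.
apply: le_trans (_ : _ <= ((size p)%:R + t)%:E)%E _; last first.
  have : (size p).+1%:R <= n%:R :> R by rewrite ler_nat; exact: leq_ltn_trans sp en.
  by rewrite lee_fin -natr1 => h; lra.
apply: intrinsic_dist_le; apply: pl_walk => //; rewrite lp.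
have -> : vpt (val e).1 = ept e 0 by rewrite edge_at_le0.
rewrite (_ : t = `|0 - t| + 0); last by rewrite sub0r normrN addr0 ger0_norm //; lra.
apply: pl_edge; rewrite ?lexx ?ler01 //.
by rewrite sub0r normrN addr0 ger0_norm; [exact: pl_nil|lra].
Qed.

(** The radius and the distances of vertices are integers, so a ball contains the interior of an
    edge entirely or not at all: the condition does not involve [t]. *)
Lemma ball_edge n e t : 0 < t < 1 -> graph_ball x (n%:R : R) (ept e t) <->
  (gdist x (val e).1 < n)%N \/ (gdist x (val e).2 < n)%N.
Proof.
have [D [Dv De DL]] := realization_dist => t01.
split=> [H|[h|h]]; first last.
- by rewrite -edge_at_redge; apply: ball_edge_half => //; lra.
- by apply: ball_edge_half => //; lra.
have : ((D (ept e t))%:E <= n%:R%:E :> \bar R)%E.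
  apply: le_trans H; apply: le_ereal_inf_tmp => _ [l /DL h <-]; rewrite lee_fin.
  by move: h; rewrite Dv gdistxx add0r.
rewrite lee_fin De; last by lra.
by rewrite ge_min -!(ltr_nat R) => /orP[h|h]; [left|right]; lra.
Qed.

End Balls.

(** * Coverings injective on a ball are isometric there *)

Section BallIsometry.
Context {R : realType} {Y X : graph} (f : Y -> X) (cf : graph_covering f).
Context (n : nat) (y : Y).
Context (finj : forall u v, within_dist n y u -> within_dist n y v -> f u = f v -> u = v).
Local Notation vpt := (vertex_point R).
Local Notation ept := (@edge_at R _).
Local Notation BY := (graph_ball y (n%:R : R)).
Local Notation BX := (graph_ball (f y) (n%:R : R)).

Lemma gdist_covering u : (gdist (f y) (f u) <= gdist y u)%N.
Proof. by apply/gdistP; apply: covering_within => //; exact: gdist_within. Qed.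

Lemma gdist_lift m z : (gdist (f y) z <= m)%N -> exists2 u, (gdist y u <= m)%N & f u = z.
Proof.
by move=> /gdistP /(covering_within_lift cf)[u /gdistP yu fu]; exists u.
Qed.

Lemma gdist_inj u v : (gdist y u <= n)%N -> (gdist y v <= n)%N -> f u = f v -> u = v.
Proof. by move=> /gdistP yu /gdistP yv; exact: finj. Qed.

(** A short walk to [f u] lifts to one ending over [f u] inside the ball, and injectivity identifies
    its end with [u]. *)
Lemma gdist_isom m u : (m <= n)%N -> (gdist y u <= n)%N -> (gdist (f y) (f u) <= m)%N ->
  (gdist y u <= m)%N.
Proof.
move=> mn un /gdist_lift[v vm fv].
by rewrite -(gdist_inj (leq_trans vm mn) un fv).
Qed.

Definition fedge (e : edge Y) : edge X :=
  exist (fun z : X * X => is_true (adj z.1 z.2)) (f (val e).1, f (val e).2)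
    (let: And3 _ h _ := cf in h _ _ (valP e)).

Lemma fedge_redge e : fedge (redge e) = redge (fedge e).
Proof. exact: val_inj. Qed.

Lemma covering_edge_lift u w : adj (f u) w -> exists2 e : edge Y,
  (val e).1 = u & f (val e).2 = w.
Proof.
have [_ _ nf] := cf; have [_ _ sf] := nf u.
move=> /sf[v uv fv]; have [e ee _] := run_adj (R := R) uv.
by exists e; rewrite ee.
Qed.

Lemma covering_local_inj u v w : adj u v -> adj u w -> f v = f w -> v = w.
Proof.
have [_ _ nf] := cf; have [_ inf _] := nf u.
by move=> uv uw; apply: inf; exact/mem_set.
Qed.

(** Rules out that an edge starting in the ball leaves it while its image stays inside. If the image
    of the far end is nearer than [n], lift it to a near vertex [v]. Some neighbour of [v] lies over
    the image of the first end, and equals this end by injectivity. So [v] and the far end are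
    neighbours of one vertex with the same image, hence equal. *)
Lemma end_near (e : edge Y) : (gdist y (val e).1 <= n)%N ->
  (gdist (f y) (f (val e).1) < n)%N \/ (gdist (f y) (f (val e).2) < n)%N ->
  (gdist y (val e).1 < n)%N \/ (gdist y (val e).2 < n)%N.
Proof.
move=> un; have n0 (m : nat) : (m < n)%N -> (n.-1 < n)%N by case: (n).
have lt1 (m : nat) : (m < n)%N -> (m <= n.-1)%N by case: (n).
case=> h; have nn := n0 _ h.
  left; apply: leq_ltn_trans nn; apply: gdist_isom => //; first exact: leq_pred.
  exact: lt1.
right; have [v vm fv] := gdist_lift (lt1 _ h).
have fe : adj (f v) (f (val e).1).
  by rewrite fv adj_sym; exact: (valP (fedge e)).
have [e' e1 e2] := covering_edge_lift fe.
have ae' : adj v (val e').2 by rewrite -e1; exact: (valP e').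
have u' : (val e').2 = (val e).1.
  apply: gdist_inj => //; apply: leq_trans (gdist_adj _ ae') _.
  exact: leq_ltn_trans vm nn.
have -> : (val e).2 = v.
  apply: (@covering_local_inj (val e).1); rewrite ?fv //; first exact: (valP e).
  by rewrite -u' adj_sym.
exact: leq_ltn_trans vm nn.
Qed.

Lemma covering_realization : exists F : realization R Y -> realization R X,
  (forall u, F (vpt u) = vpt (f u)) /\ (forall e t, F (ept e t) = ept (fedge e) t).
Proof.
have [e|e t _|F [Fv Fe]] := @realization_lift R Y _ (fun u => vpt (f u) : realization R X)
  (fun e t => ept (fedge e) t).
- by rewrite edge_at_le0.
- by rewrite fedge_redge edge_at_redge.
by exists F; split=> // e t; rewrite Fe edge_at_clamp.
Qed.

(** Both intrinsic distances are infima of the same set of lengths: a path in the ball of [Y] has an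
    image of the same length, and a path in the ball of [X] lifts with the same length without
    leaving the ball. *)
Lemma ball_isometric : intrinsically_isometric BY BX.
Proof.
have [F [Fv Fe]] := covering_realization.
have FB p : BY p -> BX (F p).
  have [[u ->]|[e [t [t01 ->]]]] := realization_cases p.
    by rewrite Fv => /ball_vertex h; apply/ball_vertex; exact: leq_trans (gdist_covering u) h.
  rewrite Fe => /(ball_edge _ _ _ t01) h; apply/(ball_edge _ _ _ t01).
  by case: h => h; [left|right]; exact: leq_ltn_trans (gdist_covering _) h.
have ends (e : edge Y) : (gdist y (val e).1 < n)%N \/ (gdist y (val e).2 < n)%N ->
    (gdist y (val e).1 <= n)%N /\ (gdist y (val e).2 <= n)%N.
  have ae : adj (val e).1 (val e).2 := valP e.
  case=> h; split; rewrite ?(ltnW h) //.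
    by apply: leq_trans (gdist_adj _ ae) _.
  by rewrite adj_sym in ae; apply: leq_trans (gdist_adj _ ae) _.
have Finj p q : BY p -> BY q -> F p = F q -> p = q.
  have [[u ->]|[e [t [t01 ->]]]] := realization_cases p;
    have [[v ->]|[e' [t' [t01' ->]]]] := realization_cases q.
  - rewrite !Fv => /ball_vertex yu /ball_vertex yv /vertex_point_inj fuv.
    by rewrite (gdist_inj yu yv fuv).
  - by rewrite Fv Fe => _ _ /vertex_point_edge_at[|[h _]|[h _]]; [lra|exfalso; lra|exfalso; lra].
  - by rewrite Fv Fe => _ _ /esym/vertex_point_edge_at[|[h _]|[h _]]; [lra|exfalso; lra|exfalso; lra].
  rewrite !Fe => /(ball_edge _ _ _ t01)/ends[a1 a2] /(ball_edge _ _ _ t01')/ends[b1 b2].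
  move=> /(edge_at_inj t01)[|[E ->]|[E ->]]; first by lra.
    have /= [E1 E2] := congr1 val E; congr edge_at; apply: val_inj.
    rewrite (surjective_pairing (val e)) (surjective_pairing (val e')).
    by rewrite (gdist_inj a1 b1 E1) (gdist_inj a2 b2 E2).
  rewrite -[RHS]edge_at_redge; rewrite -fedge_redge in E.
  have /= [E1 E2] := congr1 val E; congr edge_at; apply: val_inj.
  rewrite (surjective_pairing (val e)) /=.
  by rewrite (gdist_inj a1 b2 E1) (gdist_inj a2 b1 E2).
have Fsur q : BX q -> exists2 p, BY p & F p = q.
  have [[z ->]|[e [t [t01 ->]]]] := realization_cases q.
    by move=> /ball_vertex/gdist_lift[u yu <-]; exists (vpt u); [apply/ball_vertex|].
  have half (e0 : edge X) s : 0 < s < 1 -> (gdist (f y) (val e0).1 < n)%N ->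
      exists2 p, BY p & F p = ept e0 s.
    move=> s01 h; have [u yu fu] := gdist_lift (leqnn (gdist (f y) (val e0).1)).
    have ae : adj (f u) (val e0).2 by rewrite fu; exact: (valP e0).
    have [e' e1 e2] := covering_edge_lift ae; exists (ept e' s).
      by apply/(ball_edge _ _ _ s01); left; rewrite e1; exact: leq_ltn_trans yu h.
    rewrite Fe; congr edge_at; apply: val_inj.
    by rewrite (surjective_pairing (val e0)) /= e1 e2 fu.
  move=> /(ball_edge _ _ _ t01)[h|h]; first exact: half.
  have t01' : 0 < 1 - t < 1 by lra.
  by have [p Bp Fp] := half (redge e) (1 - t) t01' h; exists p; rewrite // Fp edge_at_redge.
have plF p q l : pl_path BY p q l -> pl_path BX (F p) (F q) l.
  elim=> [{}p Bp|e s t {}q {}l Bw _ IH]; first exact: pl_nil (FB _ Bp).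
  rewrite edge_ept Fe -edge_ept; apply: pl_cons.
    by move=> w /Bw/FB; rewrite !edge_ept Fe.
  by move: IH; rewrite !edge_ept Fe.
have lift_point e s p : 0 <= s <= 1 -> F p = ept e s ->
    exists2 e', fedge e' = e & p = ept e' s.
  move=> s01; have [[u ->]|[e0 [t [t01 ->]]]] := realization_cases p.
    rewrite Fv => /(vertex_point_edge_at s01)[[-> fu]|[-> fu]].
      have ae : adj (f u) (val e).2 by rewrite fu; exact: (valP e).
      have [e' e1 e2] := covering_edge_lift ae; exists e'; last by rewrite edge_at_le0 // e1.
      by apply: val_inj; rewrite (surjective_pairing (val e)) /= e1 e2 fu.
    have ae : adj (f u) (val e).1 by rewrite fu adj_sym; exact: (valP e).
    have [e' e1 e2] := covering_edge_lift ae; exists (redge e').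
      by apply: val_inj; rewrite (surjective_pairing (val e)) /= e1 e2 fu.
    by rewrite edge_at_ge1 //= e1.
  rewrite Fe => /(edge_at_inj t01 s01)[[E ->]|[E ->]]; first by exists e0.
  exists (redge e0); first by rewrite fedge_redge E redgeK.
  by rewrite -[LHS]edge_at_redge subKr.
have plL P Q l : pl_path BX P Q l -> forall p, BY p -> F p = P ->
    exists2 q, BY q /\ F q = Q & pl_path BY p q l.
  elim=> [{}P _ p Bp FP|e s t {}Q {}l Bw _ IH p Bp].
    by exists p => //; exact: pl_nil.
  rewrite edge_ept => /lift_point[|e' ee' pE]; first exact: unit_val_itv.
  have seg_in w : Num.min (unit_val s) (unit_val t) <= unit_val w <=
      Num.max (unit_val s) (unit_val t) -> BY (edge_point e' w).
    (* A segment reduced to a point says nothing about the rest of its edge, but then its only point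
       is [p], which is in the ball. *)
    move=> ws; have [st|st] := eqVneq (unit_val s) (unit_val t).
      rewrite edge_ept (_ : unit_val w = unit_val s) -?pE //.
      by move: ws; rewrite -st minxx maxxx; lra.
    (* The ends of the segment may be vertices; its midpoint is interior to the edge, so [ball_edge]
       applies to it. *)
    pose m : R := (unit_val s + unit_val t) / 2.
    have s01 := unit_val_itv s; have t01 := unit_val_itv t.
    have m01 : 0 < m < 1.
      by case/lt_total/orP: st => st; rewrite /m; apply/andP; split; lra.
    have mC : clamp m = m by rewrite clamp_id //; lra.
    have : BX (ept e m).
      have := Bw (clampI m); rewrite edge_ept unit_val_clampI mC; apply.
      rewrite /m; case/lt_total/orP: st => st.
        by rewrite (min_idPl (ltW st)) (max_idPr (ltW st)); lra.
      by rewrite (min_idPr (ltW st)) (max_idPl (ltW st)); lra.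
    rewrite -ee' => /(ball_edge _ _ _ m01) /= near.
    (* The starting point [p] lies on the lifted edge and in the ball, which brings one end within
       distance [n]; [end_near] does the rest, applied to the reversed edge in the second case. *)
    have [h|h] : (gdist y (val e').1 <= n)%N \/ (gdist y (val e').2 <= n)%N.
    + move: Bp; rewrite pE; have [s0|s0] := leP (unit_val s) 0.
        by rewrite edge_at_le0 // => /ball_vertex; left.
      have [s1|s1] := leP 1 (unit_val s).
        by rewrite edge_at_ge1 // => /ball_vertex; right.
      have s01' : 0 < unit_val s < 1 by rewrite s0 s1.
      by move=> /(ball_edge _ _ _ s01')/ends[]; left.
    + have {near} near := end_near h near.
      have [w0|w0] := leP (unit_val w) 0.
        by rewrite edge_ept edge_at_le0 //; apply/ball_vertex.
      have [w1|w1] := leP 1 (unit_val w).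
        by rewrite edge_ept edge_at_ge1 //; apply/ball_vertex; case: (ends _ near).
      have w01 : 0 < unit_val w < 1 by rewrite w0 w1.
      by rewrite edge_ept; apply/(ball_edge _ _ _ w01).
    + have near' : (gdist (f y) (f (val (redge e')).1) < n)%N \/
        (gdist (f y) (f (val (redge e')).2) < n)%N by case: near; [right|left].
      have {near near'} near := @end_near (redge e') h near'.
      have [e2 e1] := ends _ near.
      have [w0|w0] := leP (unit_val w) 0.
        by rewrite edge_ept edge_at_le0 //; apply/ball_vertex.
      have [w1|w1] := leP 1 (unit_val w).
        by rewrite edge_ept edge_at_ge1 //; apply/ball_vertex.
      have w01 : 0 < unit_val w < 1 by rewrite w0 w1.
      by rewrite edge_ept; apply/(ball_edge _ _ _ w01); case: near; [right|left].
  have [||q Bq pq] := IH (edge_point e' t).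
  - by apply: seg_in; rewrite ge_min le_max !lexx !orbT.
  - by rewrite !edge_ept Fe ee'.
  by exists q => //; rewrite pE -edge_ept; exact: pl_cons.
exists F; first split.
- by move=> p; exact: FB.
- by move=> p q /set_mem Bp /set_mem Bq; exact: Finj.
- by move=> q /Fsur[p Bp <-]; exists p.
move=> p q Bp Bq; congr ereal_inf; congr (image _ _); apply/seteqP; split=> l /=.
  by move=> /plL /(_ p Bp erefl)[q' [Bq' /(Finj _ _ Bq' Bq) ->]].
exact: plF.
Qed.

End BallIsometry.

Lemma intrinsically_isometric_sym (R : realType) (X Y : graph)
    (A : set (realization R X)) (B : set (realization R Y)) :
  intrinsically_isometric A B -> intrinsically_isometric B A.
Proof.
move=> [f [fAB finj fsur] fd]; have [x0 _] := graph_nonempty X.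
have /choice[g gP] : forall q, exists p, B q -> A p /\ f p = q.
  move=> q; have [Bq|nBq] := pselect (B q); last by exists (vertex_point R x0).
  by have [p Ap fp] := fsur q Bq; exists p.
exists g; first split.
- by move=> q /gP[].
- by move=> p q /set_mem/gP[_ gp] /set_mem/gP[_ gq] pq; rewrite -gp -gq pq.
- move=> p Ap; have [Ag fg] := gP _ (fAB _ Ap); exists (f p); first exact: fAB.
  by apply: finj fg; exact/mem_set.
move=> p q /gP[Ap fp] /gP[Aq fq]; have := fd _ _ Ap Aq.
by rewrite fp fq => ->.
Qed.

Lemma cover_locally_graph (R : realType) (X : graph) (k n : nat) (hk : (2 <= k)%N)
    (x0 : X) :
  (2 * n <= k)%N -> locally_graph (n%:R : R) (cover_graph hk x0) X.
Proof.
move=> nk u; exists (cover_proj u); apply: intrinsically_isometric_sym.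
apply: ball_isometric; first exact: cover_proj_covering.
by move=> v w; exact: cover_proj_inj_ball.
Qed.

Close Scope ring_scope.
Close Scope classical_set_scope.

Theorem proposition1p4 (R : realType) (n : nat) (hn : (1 <= n)%N) (X : graph)
    (hX : vertex_transitive X) (hrigid : LG_rigid (n%:R : R)%R X) :
  simply_connected_at_scale R (2 * n) X.
Proof.
have [x0 _] := graph_nonempty X.
(* Room for backtracks, needed for adjacency in the cover to be symmetric. *)
have hk : (2 <= 2 * n)%N by rewrite mul2n -addnn (leq_add hn hn).
have cov : Defs.covered_by (cover_graph hk x0) X.
  by apply: hrigid; exact: cover_locally_graph.
exact: (complex_simply_connected (walks_equiv_of_cover hX cov)).
Qed.
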